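(* Let $(\mathcal X,\rho)$ be a Polish space and $\mu\in P_2(\mathcal X)$ such that \[\forall k\in\mathbf R,\ \forall u\ne v\in\mathcal X,\qquad \mu\{x\in\mathcal X:\rho^2(x,u)-\rho^2(x,v)=k\}=0.\] If $\mu$ satisfies $\mathbf{LSI}(C)$, then $\mu$ satisfies $\mathbf T_2(2C)$.
   Context: $\mathcal T_2(\nu,\mu)=\inf_\pi\int\rho(x,y)^2d\pi$ over couplings $\pi$ of $\nu,\mu$; $H(\nu\,|\,\mu)=\int\log\frac{d\nu}{d\mu}d\nu$ if $\nu\ll\mu$, else $+\infty$. $\mu$ satisfies $\mathbf T_2(C)$ if $\mathcal T_2(\nu,\mu)\le C\,H(\nu\,|\,\mu)$ for all probability measures $\nu$. $|\nabla f|(x)=\limsup_{y\to x}|f(x)-f(y)|/\rho(x,y)$ ($0$ at isolated points). $\mu$ satisfies $\mathbf{LSI}(C)$ if $\mathrm{Ent}_\mu(f^2)\le C\int|\nabla f|^2d\mu$ for all locally Lipschitz $f$, with $\mathrm{Ent}_\mu(g)=\int g\log g\,d\mu-\int g\,d\mu\log\int g\,d\mu$. *)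

(* Defs.v *)
From HB Require Import structures.
From mathcomp Require Import all_boot all_order all_algebra.
From mathcomp Require Import all_classical all_reals all_analysis.

Set Implicit Arguments.
Unset Strict Implicit.
Unset Printing Implicit Defensive.

Import Order.TTheory GRing.Theory Num.Theory.
Import numFieldNormedType.Exports.

Local Open Scope classical_set_scope.
Local Open Scope ring_scope.

Section Defs.
Context {d : measure_display} {T : measurableType d} {R : realType}.
Implicit Types (rho : T -> T -> R).

Definition is_metric rho :=
  [/\ forall x y, rho x y = 0 <-> x = y,
      forall x y, rho x y = rho y x &
      forall x y z, rho x z <= rho x y + rho y z].

Definition rho_open rho (A : set T) :=
  forall x, A x -> exists2 r : R, 0 < r & [set y | rho x y < r] `<=` A.

Definition rho_complete rho :=
  forall u : nat -> T,
    (forall e : R, 0 < e -> exists N, forall m n, (N <= m)%N -> (N <= n)%N ->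
       rho (u m) (u n) < e) ->
    exists l, forall e : R, 0 < e -> exists N, forall n, (N <= n)%N -> rho (u n) l < e.

Definition rho_separable rho :=
  exists D : set T, countable D /\
    forall x (e : R), 0 < e -> exists2 y, D y & rho x y < e.

Definition polish rho := [/\ is_metric rho, rho_complete rho & rho_separable rho].

Definition borel_sigma rho := @measurable d T = <<s rho_open rho >>.

Definition P2 rho (mu : probability T R) :=
  exists x0, (\int[mu]_x ((rho x x0) ^+ 2)%R%:E < +oo)%E.

Definition coupling (nu mu : probability T R) (pi : probability (T * T)%type R) :=
  forall A : set T, measurable A ->
    pi (A `*` setT) = nu A /\ pi (setT `*` A) = mu A.

Definition T2cost rho (nu mu : probability T R) : \bar R :=
  ereal_inf [set (\int[pi]_z ((rho z.1 z.2) ^+ 2)%:E)%E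
            | pi in [set pi : probability (T * T)%type R | coupling nu mu pi]].

Definition relEnt (nu mu : probability T R) : \bar R :=
  if pselect (nu `<< mu) then
    (\int[nu]_x (ln (fine ((Radon_Nikodym (charge_of_finite_measure nu) mu) x)))%R%:E)%E
  else +oo%E.

Definition T2ineq rho (mu : probability T R) (C : R) :=
  forall nu : probability T R, (T2cost rho nu mu <= C%:E * relEnt nu mu)%E.

Definition isolated rho (x : T) :=
  exists2 r : R, 0 < r & forall y, rho x y < r -> y = x.

Definition slope rho (f : T -> R) (x : T) : \bar R :=
  if pselect (isolated rho x) then 0%E else
  ereal_inf [set ereal_sup [set (`|f x - f y| / rho x y)%:E
                           | y in [set y | 0 < rho x y < r]]
            | r in [set r : R | 0 < r]].

Definition loc_lipschitz rho (f : T -> R) :=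
  forall x, exists r L : R, 0 < r /\
    forall y z, rho x y < r -> rho x z < r -> `|f y - f z| <= L * rho y z.

Definition Ent (mu : probability T R) (g : T -> R) : \bar R :=
  let m := fine (\int[mu]_x (g x)%:E)%E in
  (\int[mu]_x (g x * ln (g x))%R%:E - (m * ln m)%R%:E)%E.

Definition LSI rho (mu : probability T R) (C : R) :=
  forall f : T -> R, loc_lipschitz rho f ->
    (\int[mu]_x ((f x) ^+ 2)%R%:E < +oo)%E ->
    (Ent mu (fun x => (f x ^+ 2)%R) <= C%:E * \int[mu]_x (slope rho f x * slope rho f x))%E.

End Defs.

(* Main.v *)
(* The Hamilton-Jacobi proof of the Otto-Villani theorem, arranged so that only
   finite maxima of the functions [w i - b * rho x (u i) ^+ 2] occur.  Put
     h t x = max_i (w i - rho x (u i) ^+ 2 / (1 - C t)).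
   In any metric space h decreases in t at rate at least C/4 times the square of
   its slope.  Convexity of exp bounds the increments of ln (int e^(t h_t) dmu)
   and LSI bounds the entropy of e^(t h_t), so t |-> ln (int e^(t h_t) dmu) / t is
   nonincreasing up to quadratic increments, hence nonincreasing:
     ln (int e^(s h_s) dmu) <= s int h_0 dmu.
   Gibbs' variational principle then gives
     int h_s dnu - int h_0 dmu <= H(nu|mu) / s,
   and the same monotonicity for min(rho, k)^2 / (1 + C t) in place of h t shows
   that nu has a finite second moment when H(nu|mu) is finite.
   It remains to choose u and w.  Approximate nu by a measure with finitely many
   atoms u i.  As ties have mu-measure zero, there are weights w whose Laguerre
   cells have the mu-masses of the atoms, and sending each cell to its atom is a
   transport whose cost is expressed exactly by w and h_0.  Gluing it block by
   block with the approximation of nu yields a coupling of nu and mu.  The time s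
   must stay below 1 / C; with s = 3 / (4 C) the loss in s and the loss in the
   gluing together account for the factor 2. *)
Require Import Defs.
From HB Require Import structures.
From mathcomp Require Import all_boot all_order all_algebra.
From mathcomp Require Import all_classical all_reals all_analysis.
From mathcomp Require Import measurable_realfun ring lra.
Import Order.TTheory GRing.Theory Num.Theory.
Import numFieldNormedType.Exports.
Local Open Scope classical_set_scope.
Local Open Scope ring_scope.

(** * Integrals of exponentials: Jensen's inequality and tangent lines *)

Section integral_tools.
Context {d : measure_display} {T : measurableType d} {R : realType}.
Variable mu : probability T R.

(** The integral of a nonnegative function is a supremum over the simple functions below it, and a
    larger function admits more of them. This bounds the integral of the slope, whose measurability
    is not established. *)
Lemma lower_integral_le (f g : T -> \bar R) :
  (forall x, 0 <= f x)%E -> (forall x, f x <= g x)%E ->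
  (\int[mu]_x f x <= \int[mu]_x g x)%E.
Proof.
move=> f0 fg; rewrite !ge0_integralTE//; last first.
  by move=> x; exact: le_trans (fg x).
apply: ereal_sup_le => _ [h hf <-]; exists h => // x.
exact: le_trans (hf x) (fg x).
Qed.

Lemma integrable_le_scale (f g : T -> R) (c : R) :
  measurable_fun setT f -> mu.-integrable setT (EFin \o g) ->
  (forall x, `|f x| <= c * g x) -> mu.-integrable setT (EFin \o f).
Proof.
move=> mf ig fg.
have := integrableZl measurableT c ig.
apply: le_integrable => //; first exact/measurable_EFinP.
by move=> x _ /=; rewrite lee_fin (le_trans (fg x))// ler_norm.
Qed.

Lemma integrable_bounded (f : T -> R) (c : R) :
  measurable_fun setT f -> (forall x, `|f x| <= c) ->
  mu.-integrable setT (EFin \o f).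
Proof.
move=> mf fc; apply: (@integrable_le_scale f (fun=> 1) c) => //.
  exact: finite_measure_integrable_cst.
by move=> x; rewrite mulr1.
Qed.

Lemma Rintegral1 (c : R) : \int[mu]_x c = c.
Proof. by rewrite Rintegral_cst// [X in fine X]probability_setT mulr1. Qed.

Lemma EFin_Rintegral (f : T -> R) : mu.-integrable setT (EFin \o f) ->
  (\int[mu]_x (f x)%:E)%E = (\int[mu]_x f x)%:E.
Proof. by move=> fi; rewrite /Rintegral fineK//; exact: integrable_fin_num. Qed.

Lemma expR_tangent (x c : R) : expR c * (1 + (x - c)) <= expR x.
Proof.
have -> : expR x = expR c * expR (x - c) by rewrite -expRD subrKC.
by rewrite ler_pM2l ?expR_gt0// expR_ge1Dx.
Qed.

(** Integrate the tangent line of exp at the mean of [g]. *)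
Lemma jensen_expR (g : T -> R) : mu.-integrable setT (EFin \o g) ->
  mu.-integrable setT (EFin \o (expR \o g)) ->
  expR (\int[mu]_x g x) <= \int[mu]_x expR (g x).
Proof.
move=> ig ie; set c := \int[mu]_x g x.
have i1 : mu.-integrable setT (EFin \o (fun=> 1 - c : R)).
  exact: finite_measure_integrable_cst.
have i2 : mu.-integrable setT (EFin \o (fun x => 1 - c + g x)).
  exact: (integrableD _ i1 ig).
have i3 := integrableZl measurableT (expR c) i2.
apply: le_trans (_ : \int[mu]_x (expR c * (1 - c + g x)) <= _); last first.
  apply: le_Rintegral => // x _ /=.
  by apply: le_trans (expR_tangent _ c); rewrite addrA addrAC.
by rewrite RintegralZl// RintegralD// Rintegral1 subrK mulr1.
Qed.

(** The log-partition function is convex, hence above its tangent at [g]. With [c] the mean of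
    [g' - g] under the density e^g / Z, integrate the tangent line of exp at [c + g x]: its linear
    part integrates to zero and e^c Z remains. *)
Lemma ln_Rintegral_expR_shift (g g' : T -> R) :
  0 < \int[mu]_x expR (g x) ->
  mu.-integrable setT (EFin \o (expR \o g)) ->
  mu.-integrable setT (EFin \o (expR \o g')) ->
  mu.-integrable setT (EFin \o (fun x => (g' x - g x) * expR (g x))) ->
  ln (\int[mu]_x expR (g x)) +
    (\int[mu]_x ((g' x - g x) * expR (g x))) / (\int[mu]_x expR (g x))
  <= ln (\int[mu]_x expR (g' x)).
Proof.
move=> Z0 ig ig' igg'; set Z := \int[mu]_x expR (g x).
set I := \int[mu]_x ((g' x - g x) * expR (g x)); set c := I / Z.
suff H : expR c * Z <= \int[mu]_x expR (g' x).
  have Z'0 : 0 < \int[mu]_x expR (g' x).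
    by apply: lt_le_trans H; rewrite mulr_gt0// expR_gt0.
  rewrite -ler_expR expRD !lnK// mulrC//.
have i1 := integrableZl measurableT (1 - c) ig.
have i2 : mu.-integrable setT
   (EFin \o (fun x => (1 - c) * expR (g x) + (g' x - g x) * expR (g x))).
  exact: (integrableD _ i1 igg').
have i3 := integrableZl measurableT (expR c) i2.
apply: le_trans (_ : \int[mu]_x (expR c *
   ((1 - c) * expR (g x) + (g' x - g x) * expR (g x))) <= _); last first.
  apply: le_Rintegral => // x _ /=.
  apply: le_trans (expR_tangent _ (c + g x)); rewrite expRD.
  by rewrite le_eqVlt; apply/orP; left; apply/eqP; ring.
rewrite RintegralZl// RintegralD// RintegralZl// -/I -/Z.
have IE : I = c * Z by rewrite /c divfK// gt_eqF.
by rewrite [X in _ + X]IE -mulrDl subrK mul1r.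
Qed.

End integral_tools.

(** Cut [a, b] into n equal pieces: the increments add up to at most K (b - a)^2 / n, which falls
    below any positive F b - F a once n is large. *)
Lemma le_of_quadratic_increments {R : realType} (F : R -> R) (a b K : R) :
  a <= b ->
  (forall u v, a <= u -> u <= v -> v <= b -> F v - F u <= K * (v - u) ^+ 2) ->
  F b <= F a.
Proof.
move=> ab HF; rewrite leNgt; apply/negP => Fab.
have e0 : 0 < F b - F a by rewrite subr_gt0.
have eK : F b - F a <= K * (b - a) ^+ 2 by apply: HF.
have n0 : 0 <= K * (b - a) ^+ 2 / (F b - F a).
  by rewrite divr_ge0 ?(ltW e0)// (le_trans _ eK)// ltW.
set n := (Num.bound (K * (b - a) ^+ 2 / (F b - F a))).
have nlt : K * (b - a) ^+ 2 / (F b - F a) < n%:R by exact: archi_boundP.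
have ngt0 : 0 < n%:R :> R by apply: le_lt_trans nlt.
pose delta := (b - a) / n%:R.
have d0 : 0 <= delta by rewrite divr_ge0 ?subr_ge0// ltW.
have nd : n%:R * delta = b - a by rewrite /delta mulrC divfK// gt_eqF.
have H k : (k <= n)%N -> F (a + k%:R * delta) - F a <= k%:R * (K * delta ^+ 2).
  elim: k => [_|k IH kn]; first by rewrite !mul0r addr0 subrr.
  have kn' : k.+1%:R * delta <= b - a by rewrite -nd ler_wpM2r// ler_nat.
  have ka : 0 <= k%:R * delta by rewrite mulr_ge0.
  have {IH} := IH (ltnW kn).
  have := HF (a + k%:R * delta) (a + k.+1%:R * delta).
  rewrite -natr1 !mulrDl !mul1r in kn' *.
  rewrite (_ : a + (k%:R * delta + delta) - (a + k%:R * delta) = delta); last by ring.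
  by move=> /(_ ltac:(lra) ltac:(lra) ltac:(lra)); lra.
have := H n (leqnn n); rewrite nd subrKC => {}H.
have : (F b - F a) * n%:R <= K * (b - a) ^+ 2.
  rewrite -nd exprMn expr2; apply: le_trans (ler_wpM2r (ltW ngt0) H) _.
  by rewrite le_eqVlt; apply/orP; left; apply/eqP; ring.
by move: nlt; rewrite ltr_pdivrMr// ltNge mulrC => /negP; apply.
Qed.

(** * Monotonicity of exponential moments along a Hamilton-Jacobi family *)

Section hamilton_jacobi_lsi.
Context {d : measure_display} {T : measurableType d} {R : realType}.
Variables (rho : T -> T -> R) (mu : probability T R) (C : R).
Hypotheses (C0 : 0 < C) (lsi : LSI rho mu C).
(* [E t] stands for a quarter of the squared slope of [h t], and [h_decr] is the
   Hamilton-Jacobi inequality up to an error of second order in [v - u]. *)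
Variables (h E : R -> T -> R) (Q : T -> R) (s B K : R).
Hypotheses (s0 : 0 < s) (B0 : 0 <= B) (K0 : 0 <= K).
Hypothesis mh : forall t : R, 0 <= t <= s -> measurable_fun setT (h t).
Hypothesis mE : forall t : R, 0 <= t <= s -> measurable_fun setT (E t).
Hypothesis iQ : mu.-integrable setT (EFin \o Q).
Hypothesis hQ : forall (t : R) x, 0 <= t <= s -> `|h t x| <= Q x.
Hypothesis hB : forall (t : R) x, 0 <= t <= s -> h t x <= B.
Hypothesis E0 : forall (t : R) x, 0 <= t <= s -> 0 <= E t x.
Hypothesis EQ : forall (t : R) x, 0 <= t <= s -> E t x <= Q x.
Hypothesis h_le0 : forall (t : R) x, 0 <= t <= s -> h t x <= h 0 x.
Hypothesis h_decr : forall (u v : R) x, 0 <= u -> u <= v -> v <= s ->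
  h v x <= h u x - (C - K * (v - u)) * (v - u) * E v x.
Hypothesis h_lip : forall t : R, 0 <= t <= s ->
  loc_lipschitz rho (fun x => expR (t * h t x / 2)).
Hypothesis h_slope : forall (t : R) x, 0 <= t <= s ->
  (slope rho (fun x => expR (t * h t x / 2)) x *
   slope rho (fun x => expR (t * h t x / 2)) x <=
   (t ^+ 2 * E t x * expR (t * h t x))%:E)%E.

Let Q0 x : 0 <= Q x.
Proof. by apply: le_trans (hQ 0 x _) => //; rewrite lexx ltW. Qed.

Let weight_le (v : R) x : 0 <= v <= s -> expR (v * h v x) <= expR (s * B).
Proof.
move=> /andP[v0 vs]; rewrite ler_expR.
apply: le_trans (_ : v * B <= _); last exact: ler_wpM2r.
by apply: ler_wpM2l => //; apply: hB; rewrite v0.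
Qed.

Let mweight (v : R) : 0 <= v <= s -> measurable_fun setT (fun x => expR (v * h v x)).
Proof.
move=> vs; apply: measurableT_comp => //; apply: measurable_funM => //.
exact: mh.
Qed.

Let iweighted (v : R) (f : T -> R) : 0 <= v <= s -> measurable_fun setT f ->
  (forall x, `|f x| <= Q x) ->
  mu.-integrable setT (EFin \o (fun x => f x * expR (v * h v x))).
Proof.
move=> vs mf fQ; apply: (@integrable_le_scale _ _ _ _ _ Q (expR (s * B))) => //.
  by apply: measurable_funM => //; exact: mweight.
move=> x; rewrite normrM mulrC; apply: ler_pM => //.
by rewrite ger0_norm ?expR_ge0// weight_le.
Qed.

Let iweight (v : R) : 0 <= v <= s ->
  mu.-integrable setT (EFin \o (fun x => expR (v * h v x))).
Proof.
move=> vs; apply: (@integrable_bounded _ _ _ _ _ (expR (s * B))).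
  exact: mweight.
by move=> x; rewrite ger0_norm ?expR_ge0// weight_le.
Qed.

Let ih (v : R) : 0 <= v <= s -> mu.-integrable setT (EFin \o h v).
Proof.
move=> vs; apply: (@integrable_le_scale _ _ _ _ _ Q 1) => //; first exact: mh.
by move=> x; rewrite mul1r hQ.
Qed.

Let Z v := \int[mu]_x expR (v * h v x).
Let N v := \int[mu]_x (E v x * expR (v * h v x)).
Let A v := \int[mu]_x (h v x * expR (v * h v x)).
Let q := \int[mu]_x Q x.

(** Jensen's inequality and [h v >= - Q] keep [Z] away from 0 uniformly in [v], so that [N v / Z v]
    stays bounded. *)
Let Z_ge (v : R) : 0 <= v <= s -> expR (- (s * q)) <= Z v.
Proof.
move=> vs; have /andP[v0 vs'] := vs.
have ihv := integrableZl measurableT v (ih _ vs).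
apply: le_trans (jensen_expR _ (fun x => v * h v x) ihv (iweight _ vs)).
rewrite ler_expR RintegralZl//; last exact: ih.
have hq : - q <= \int[mu]_x h v x.
  rewrite /q -[- _]mulN1r -RintegralZl//; apply: le_Rintegral => //.
  - exact: (integrableZl measurableT (-1) iQ).
  - exact: ih.
  - by move=> x _; rewrite mulN1r; have := hQ _ x vs; rewrite ler_norml => /andP[].
apply: le_trans (_ : v * - q <= _); last exact: ler_wpM2l.
rewrite mulrN lerN2; apply: ler_wpM2r => //.
by apply: Rintegral_ge0.
Qed.

Let Z_gt0 (v : R) : 0 <= v <= s -> 0 < Z v.
Proof. by move=> vs; apply: lt_le_trans (Z_ge _ vs); exact: expR_gt0. Qed.

Let N_bounds (v : R) : 0 <= v <= s -> 0 <= N v <= expR (s * B) * q.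
Proof.
move=> vs; apply/andP; split.
  by apply: Rintegral_ge0 => x _; rewrite mulr_ge0 ?expR_ge0// E0.
rewrite -RintegralZl//; apply: le_Rintegral => //.
- apply: iweighted => //; first exact: mE.
  by move=> x; rewrite ger0_norm ?E0// EQ.
- exact: (integrableZl measurableT _ iQ).
- move=> x _; rewrite mulrC; apply: ler_pM; rewrite ?expR_ge0 ?E0//.
    exact: weight_le.
  exact: EQ.
Qed.

(** LSI for f = e^(v h_v / 2): the entropy of f^2 = e^(v h_v) is v A - Z ln Z, and [h_slope] bounds
    the squared slope of f. *)
Let lsi_bound (v : R) : 0 <= v <= s ->
  v * A v - Z v * ln (Z v) <= C * (v ^+ 2 * N v).
Proof.
move=> vs; set f := fun x => expR (v * h v x / 2).
have f2 x : f x ^+ 2 = expR (v * h v x).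
  by rewrite /f -expRM_natl; congr expR; field.
have iE : mu.-integrable setT (EFin \o (fun x => E v x * expR (v * h v x))).
  apply: iweighted => //; first exact: mE.
  by move=> x; rewrite ger0_norm ?E0// EQ.
have ihw : mu.-integrable setT (EFin \o (fun x => h v x * expR (v * h v x))).
  by apply: iweighted => //; [exact: mh|move=> x; exact: hQ].
have := lsi _ (h_lip _ vs); rewrite -/f.
under eq_integral do rewrite f2.
rewrite EFin_Rintegral; last exact: iweight.
rewrite ltry => /(_ isT) H.
have {H} := le_trans H _; move=> /(_ (C * (v ^+ 2 * N v))%:E).
have -> : Ent mu (fun x => f x ^+ 2) = (v * A v - Z v * ln (Z v))%:E.
  rewrite /Ent.
  under eq_integral do rewrite f2 expRK mulrC -mulrA.
  under [X in fine X]eq_integral do rewrite f2.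
  by rewrite EFin_Rintegral ?RintegralZl //; exact: (integrableZl measurableT v ihw).
rewrite lee_fin; apply.
rewrite EFinM lee_wpmul2l//; first by rewrite lee_fin ltW.
rewrite /N -RintegralZl// -EFin_Rintegral; last first.
  exact: (integrableZl measurableT (v ^+ 2) iE).
apply: lower_integral_le => x; first exact: sqre_ge0.
by apply: le_trans (h_slope _ _ vs) _; rewrite mulrA.
Qed.

(** Convexity of the log-partition function, the decrease of [h] and the entropy bound are combined
    so that all terms of first order in [v - u] cancel. *)
Let step (u v : R) : 0 < u -> u <= v -> v <= s ->
  ln (Z v) / v - ln (Z u) / u <=
  (C + K * s) * (expR (s * B) * q * expR (s * q)) / u * (v - u) ^+ 2.
Proof.
move=> u0 uv vs.
have v0 : 0 < v by apply: lt_le_trans uv.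
have vr : 0 <= v <= s by rewrite ltW.
have ur : 0 <= u <= s by rewrite ltW//= (le_trans uv).
have Zv := Z_gt0 _ vr.
have ihw : mu.-integrable setT (EFin \o (fun x => h v x * expR (v * h v x))).
  by apply: iweighted => //; [exact: mh|move=> x; exact: hQ].
have iEw : mu.-integrable setT (EFin \o (fun x => E v x * expR (v * h v x))).
  apply: iweighted => //; first exact: mE.
  by move=> x; rewrite ger0_norm ?E0// EQ.
have ihuw : mu.-integrable setT (EFin \o (fun x => h u x * expR (v * h v x))).
  by apply: iweighted => //; [exact: mh|move=> x; exact: hQ].
have idw : mu.-integrable setT
    (EFin \o (fun x => (u * h u x - v * h v x) * expR (v * h v x))).
  have := integrableB measurableT (integrableZl measurableT u ihuw)
                                (integrableZl measurableT v ihw).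
  by apply: eq_integrable => // x _ /=; rewrite -!EFinM -EFinB; congr EFin; ring.
have J := ln_Rintegral_expR_shift _ _ (fun x => u * h u x) Zv (iweight _ vr)
   (iweight _ ur) idw.
have ilow : mu.-integrable setT (EFin \o (fun x =>
    (- (v - u)) * (h v x * expR (v * h v x)) +
    (u * (v - u) * (C - K * (v - u))) * (E v x * expR (v * h v x)))).
  exact: (integrableD measurableT (integrableZl measurableT _ ihw)
                                (integrableZl measurableT _ iEw)).
(* Write u h_u - v h_v as u (h_u - h_v) - (v - u) h_v and insert the guaranteed decrease. *)
have I : - (v - u) * A v + u * (v - u) * (C - K * (v - u)) * N v <=
    \int[mu]_x ((u * h u x - v * h v x) * expR (v * h v x)).
  rewrite /A /N -!RintegralZl// -RintegralD//; last 2 first.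
  - exact: (integrableZl measurableT _ ihw).
  - exact: (integrableZl measurableT _ iEw).
  apply: le_Rintegral => // x _; rewrite !mulrA -mulrDl.
  apply: ler_wpM2r; first exact: expR_ge0.
  have := ler_wpM2l (ltW u0) (h_decr u v x (ltW u0) uv vs).
  by nra.
have L := lsi_bound _ vr.
have [N0 NB] := andP (N_bounds _ vr).
have NZ : N v / Z v <= expR (s * B) * q * expR (s * q).
  have := Z_ge _ vr; rewrite expRN => ZB.
  rewrite ler_pdivrMr//; apply: (le_trans NB).
  rewrite -[leRHS]mulrA ler_peMr//; first exact: le_trans NB.
  by rewrite -ler_pdivrMl ?expR_gt0// mulr1.
have NZ0 : 0 <= N v / Z v by rewrite divr_ge0// ltW.
set a := A v / Z v; set n := N v / Z v in NZ NZ0 *.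
have L' : v * a - ln (Z v) <= C * (v ^+ 2 * n).
  rewrite -(ler_pM2r Zv).
  have -> : (v * a - ln (Z v)) * Z v = v * A v - Z v * ln (Z v).
    by rewrite /a; field; rewrite gt_eqF.
  have -> // : C * (v ^+ 2 * n) * Z v = C * (v ^+ 2 * N v).
  by rewrite /n; field; rewrite gt_eqF.
have I' : - (v - u) * a + u * (v - u) * (C - K * (v - u)) * n <=
    (\int[mu]_x ((u * h u x - v * h v x) * expR (v * h v x))) / Z v.
  rewrite ler_pdivlMr//; apply: le_trans I.
  by rewrite le_eqVlt; apply/orP; left; apply/eqP; rewrite /a /n; field; rewrite gt_eqF.
have {}J : ln (Z v) + (- (v - u) * a + u * (v - u) * (C - K * (v - u)) * n)
    <= ln (Z u) by apply: le_trans J; rewrite lerD2l.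
set M := expR (s * B) * q * expR (s * q) in NZ *.
have -> : ln (Z v) / v - ln (Z u) / u = (u * ln (Z v) - v * ln (Z u)) / (u * v).
  by field; rewrite !gt_eqF.
have uv0 : 0 <= v - u by rewrite subr_ge0.
(* Weighting the convexity bound by [v] and the entropy bound by [v - u] cancels the mean [a]; the
   energy terms C v^2 n and C u v n differ by one more factor [v - u]. *)
have step1 : u * ln (Z v) - v * ln (Z u) <=
    v * ((v - u) ^+ 2 * (C + K * u) * n).
  have := ler_wpM2l (ltW v0) J.
  have := ler_wpM2l uv0 L'.
  by rewrite expr2; lra.
rewrite ler_pdivrMr ?mulr_gt0//; apply: (le_trans step1).
have -> : (C + K * s) * M / u * (v - u) ^+ 2 * (u * v) =
   v * ((v - u) ^+ 2 * ((C + K * s) * M)) by field; rewrite gt_eqF.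
rewrite ler_pM2l// -mulrA ler_wpM2l ?sqr_ge0//.
apply: ler_pM => //.
  by rewrite addr_ge0 ?mulr_ge0// ltW.
by rewrite lerD2l ler_wpM2l// (le_trans uv).
Qed.

(** On [t, s] the factor 1 / u in [step] is at most 1 / t, so the increments are quadratic with a
    uniform constant. *)
Let ln_Z_decr (t : R) : 0 < t -> t <= s -> ln (Z s) / s <= ln (Z t) / t.
Proof.
move=> t0 ts.
apply: (@le_of_quadratic_increments _ (fun v => ln (Z v) / v) t s
  ((C + K * s) * (expR (s * B) * q * expR (s * q)) / t)) => // u v tu uv vs.
have u0 : 0 < u by apply: lt_le_trans tu.
apply: le_trans (step _ _ u0 uv vs) _.
apply: ler_wpM2r; first exact: sqr_ge0.
apply: ler_wpM2l; last by rewrite lef_pV2.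
rewrite !mulr_ge0 ?expR_ge0 ?addr_ge0 ?mulr_ge0// ?(ltW C0) ?(ltW s0)//.
exact: Rintegral_ge0.
Qed.

(** Controls the quotient 0 / 0 at t = 0: use ln z <= z - 1, then h_t <= h_0, then e^y - 1 <= y e^y
    with y = t h_0. *)
Let ln_Z_small (t : R) : 0 < t -> t <= s ->
  ln (Z t) / t <= \int[mu]_x (h 0 x * expR (t * h 0 x)).
Proof.
move=> t0 ts; have tr : 0 <= t <= s by rewrite ltW.
have r0 : 0 <= (0 : R) <= s by rewrite lexx ltW.
have Zt := Z_gt0 _ tr.
have i0 : mu.-integrable setT (EFin \o (fun x => h 0 x * expR (t * h 0 x))).
  apply: (@integrable_le_scale _ _ _ _ _ Q (expR (s * B))) => //.
    apply: measurable_funM; first exact: mh.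
    by apply: measurableT_comp => //; apply: measurable_funM => //; exact: mh.
  move=> x; rewrite normrM mulrC; apply: ler_pM; rewrite ?normr_ge0//; last exact: hQ.
  rewrite ger0_norm ?expR_ge0// ler_expR.
  apply: le_trans (_ : t * B <= _); last exact: ler_wpM2r.
  by apply: ler_wpM2l; [exact: ltW|exact: hB].
rewrite ler_pdivrMr// mulrC; apply: le_trans (_ : Z t - 1 <= _).
  by rewrite -ler_expR lnK//; apply: le_trans (expR_ge1Dx _); rewrite subrKC.
rewrite -RintegralZl//.
have -> : Z t - 1 = \int[mu]_x (expR (t * h t x) - 1).
  rewrite RintegralB// ?Rintegral1//; first exact: iweight.
  exact: finite_measure_integrable_cst.
apply: le_Rintegral => //.
- apply: (@integrableB _ _ _ mu setT measurableT (EFin \o _) (EFin \o (fun=> 1))).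
    exact: iweight.
  exact: finite_measure_integrable_cst.
- exact: (integrableZl measurableT t i0).
- move=> x _.
  have h0t : t * h t x <= t * h 0 x.
    apply: ler_wpM2l; first exact: ltW.
    exact: h_le0.
  apply: le_trans (_ : expR (t * h 0 x) - 1 <= _).
    by rewrite lerD2r ler_expR.
  rewrite mulrA; have := expR_tangent 0 (t * h 0 x); rewrite expR0; lra.
Qed.

(** Monotonicity reaches down to every t > 0. Along t = s / (n + 1), dominated convergence removes
    the exponential from the bound of [ln_Z_small]. *)
Theorem ln_Rintegral_hamilton_jacobi :
  ln (\int[mu]_x expR (s * h s x)) / s <= \int[mu]_x h 0 x.
Proof.
have r0 : 0 <= (0 : R) <= s by rewrite lexx ltW.
pose t n : R := s / n.+1%:R.
have tn0 n : 0 < t n by rewrite divr_gt0.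
have tns n : t n <= s by rewrite ler_pdivrMr// ler_peMr ?(ltW s0)// ler1n.
have t_cvg : t n @[n --> \oo] --> (0 : R).
  rewrite -(mulr0 s); apply: cvgMl_tmp; exact: cvg_harmonic.
pose f n x := (h 0 x * expR (t n * h 0 x))%:E.
have mf n : measurable_fun setT (f n).
  apply/measurable_EFinP; apply: measurable_funM; first exact: mh.
  by apply: measurableT_comp => //; apply: measurable_funM => //; exact: mh.
have fQ n x : (`|f n x| <= (expR (s * B) * Q x)%:E)%E.
  rewrite lee_fin normrM mulrC; apply: ler_pM; rewrite ?normr_ge0//; last exact: hQ.
  rewrite ger0_norm ?expR_ge0// ler_expR.
  apply: le_trans (_ : t n * B <= _); last exact: ler_wpM2r.
  by apply: ler_wpM2l; [exact: ltW|exact: hB].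
have [] := @dominated_convergence _ _ _ mu setT measurableT f (EFin \o h 0)
   (fun x => (expR (s * B) * Q x)%:E) mf.
- by apply/measurable_EFinP; exact: mh.
- apply: aeW => x _; apply: cvg_EFin; first by near=> n.
  rewrite -[X in _ --> X]mulr1; apply: cvgMl_tmp.
  rewrite -expR0 -[X in expR X](mul0r (h 0 x)).
  have c1 : t n * h 0 x @[n --> \oo] --> 0 * h 0 x by exact: cvgMr_tmp.
  apply: (@continuous_cvg _ _ _ _ _ _ expR _ (@continuous_expR R _) c1).
- exact: (integrableZl measurableT _ iQ).
- by apply: aeW => x n _; exact: fQ.
move=> _ _ fcvg; rewrite -lee_fin -[leRHS]EFin_Rintegral; last exact: ih.
apply: (cvge_ge _ fcvg).
apply: nearW => n.
have i0 : mu.-integrable setT (EFin \o (fun x => h 0 x * expR (t n * h 0 x))).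
  apply: (@integrable_le_scale _ _ _ _ _ Q (expR (s * B))) => //.
    by apply/measurable_EFinP; exact: mf.
  by move=> x; rewrite -lee_fin; exact: fQ.
rewrite /= /f. rewrite EFin_Rintegral// lee_fin.
by apply: le_trans (ln_Z_decr _ (tn0 n) (tns n)) _; exact: ln_Z_small.
Unshelve. all: by end_near.
Qed.

End hamilton_jacobi_lsi.

(** * Metric slopes, local Lipschitz bounds and measurability of the distance *)

Section metric_space.
Context {d : measure_display} {T : measurableType d} {R : realType}.
Variable rho : T -> T -> R.
Hypothesis met : is_metric rho.

Lemma metricxx x : rho x x = 0. Proof. by case: met => H _ _; apply/H. Qed.

Lemma metricC x y : rho x y = rho y x. Proof. by case: met. Qed.

Lemma metric_triangle x y z : rho x z <= rho x y + rho y z.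
Proof. by case: met. Qed.

Lemma metric_ge0 x y : 0 <= rho x y.
Proof.
by have := metric_triangle x y x; rewrite metricxx (metricC y x); lra.
Qed.

Lemma metric_eq0 x y : rho x y = 0 -> x = y.
Proof. by case: met => H _ _ /H. Qed.

Lemma metric_lip u x y : `|rho x u - rho y u| <= rho x y.
Proof.
have := metric_triangle x y u; have := metric_triangle y x u.
by rewrite (metricC y x) ler_norml; lra.
Qed.

(* [slope_bound f x G] says that the upper limit defining the slope is at
   most [G], without using the division by [rho x y]. *)
Definition slope_bound (f : T -> R) (x : T) (G : R) :=
  forall e, 0 < e -> exists2 r, 0 < r &
    forall y, rho x y < r -> `|f x - f y| <= (G + e) * rho x y.

(** Around a point that is not isolated every punctured ball is nonempty, so none of the suprema is
    the empty one, -oo. *)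
Lemma slope_ge0 (f : T -> R) x : (0 <= slope rho f x)%E.
Proof.
rewrite /slope; case: pselect => // ni; apply: le_ereal_inf_tmp => a [r r0 <-{a}].
have [y [yr yx]] : exists y, rho x y < r /\ y <> x.
  apply: contrapT => H; apply: ni; exists r => // y yr.
  by apply: contrapT => yx; apply: H; exists y.
apply: (@le_trans _ _ (`|f x - f y| / rho x y)%:E).
  by rewrite lee_fin divr_ge0// metric_ge0.
apply: ereal_sup_ubound; exists y => //=; rewrite yr andbT lt_neqAle metric_ge0 andbT.
by apply/eqP => /esym/metric_eq0/esym.
Qed.

Lemma slope_le (f : T -> R) x (G : R) : 0 <= G ->
  slope_bound f x G -> (slope rho f x <= G%:E)%E.
Proof.
move=> G0 H; rewrite /slope; case: pselect => [?|?]; first by rewrite lee_fin.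
apply/lee_addgt0Pr => e e0; have [r r0 Hr] := H e e0.
apply: ge_ereal_inf; exists (ereal_sup [set (`|f x - f y| / rho x y)%:E
                           | y in [set y | 0 < rho x y < r]]).
  by exists r.
apply: ge_ereal_sup => /= _ [y /= /andP[y0 yr] <-].
by rewrite -EFinD lee_fin ler_pdivrMr// Hr.
Qed.

Lemma slope_sqr_le (f : T -> R) x (G : R) : 0 <= G ->
  slope_bound f x G -> (slope rho f x * slope rho f x <= (G ^+ 2)%:E)%E.
Proof.
move=> G0 H; rewrite expr2 EFinM; apply: lee_pmul; rewrite ?slope_ge0//;
exact: slope_le.
Qed.

Lemma slope_bound_scale (f : T -> R) x (G c : R) : 0 <= c ->
  slope_bound f x G -> slope_bound (fun y => c * f y) x (c * G).
Proof.
(* Dividing by [c + 1] instead of [c] covers c = 0. *)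
move=> c0 H e e0; have [r r0 Hr] := H (e / (c + 1)) ltac:(by rewrite divr_gt0; lra).
exists r => // y yr; rewrite -mulrBr normrM (ger0_norm c0).
apply: le_trans (ler_wpM2l c0 (Hr y yr)) _.
rewrite mulrA; apply: ler_wpM2r; first exact: metric_ge0.
by rewrite mulrDr lerD2l mulrA ler_pdivrMr; nra.
Qed.

(** For b <= a, factor out e^a and use 1 + y <= e^y at y = b - a. *)
Lemma expR_dist (a b : R) : `|expR a - expR b| <= expR (Num.max a b) * `|a - b|.
Proof.
wlog ab : a b / b <= a => [H|].
  have /orP[/H//|/H] := le_total b a.
  by rewrite (distrC (expR b)) (distrC b) maxC.
rewrite (max_idPl ab) !ger0_norm ?subr_ge0 ?ler_expR//.
have := expR_ge1Dx (b - a); have := expR_gt0 a.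
have -> : expR b = expR a * expR (b - a) by rewrite -expRD subrKC.
by nra.
Qed.

Lemma slope_bound_expR (g : T -> R) x (G : R) : 0 <= G ->
  slope_bound g x G -> slope_bound (expR \o g) x (G * expR (g x)).
Proof.
move=> G0 H e e0; set E := expR (g x); have E0 : 0 < E by exact: expR_gt0.
(* As e' <= 1, the product (1 + e') (G + e') exceeds G by at most (G + 2) e', which times [E] is at
   most [e]. *)
pose e' := Num.min 1 (e / E / (G + 2)).
have e'0 : 0 < e'.
  by rewrite /e' lt_min ltr01 !divr_gt0//; lra.
have e'1 : e' <= 1 by rewrite /e' ge_min lexx.
have e'E : E * ((G + 2) * e') <= e.
  rewrite mulrC -ler_pdivlMr// mulrC -ler_pdivlMr; last lra.
  by rewrite /e' ge_min lexx orbT.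
have [r r0 Hr] := H e' e'0.
have l0 : 0 < ln (1 + e') by apply: ln_gt0; lra.
(* The second radius keeps g within ln (1 + e') of g x, hence e^g below E (1 + e'). *)
exists (Num.min r (ln (1 + e') / (G + 1))).
  by rewrite lt_min r0 divr_gt0//; lra.
move=> y; rewrite lt_min => /andP[yr yl]; rewrite /comp.
have {}Hr := Hr y yr; have y0 := metric_ge0 x y.
have dl : `|g x - g y| <= ln (1 + e').
  apply: (le_trans Hr); move: yl; rewrite ltr_pdivlMr; last lra.
  by nra.
have M : expR (Num.max (g x) (g y)) <= E * (1 + e').
  apply: le_trans (_ : expR (g x + ln (1 + e')) <= _).
    rewrite ler_expR ge_max; move: dl; rewrite ler_norml => /andP[]; lra.
  by rewrite expRD lnK// posrE; lra.
apply: le_trans (expR_dist _ _) _.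
apply: le_trans (ler_pM _ _ M Hr) _; rewrite ?expR_ge0//.
rewrite mulrA; apply: ler_wpM2r => //.
have -> : E * (1 + e') * (G + e') = G * E + E * ((G + 1 + e') * e') by ring.
rewrite lerD2l; apply: le_trans e'E; rewrite ler_pM2l// ler_pM2r//; lra.
Qed.

Lemma loc_lipschitz_expR (g : T -> R) (B : R) : (forall x, g x <= B) ->
  loc_lipschitz rho g -> loc_lipschitz rho (expR \o g).
Proof.
move=> gB H x; have [r [L [r0 Hr]]] := H x.
exists r, (expR B * L); split => // y z xy xz; rewrite /comp.
apply: le_trans (expR_dist _ _) _; rewrite -mulrA; apply: ler_pM => //.
- by rewrite ler_expR ge_max !gB.
- exact: Hr.
Qed.

Lemma loc_lipschitz_scale (g : T -> R) (c : R) :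
  loc_lipschitz rho g -> loc_lipschitz rho (fun x => c * g x).
Proof.
move=> H x; have [r [L [r0 Hr]]] := H x.
exists r, (`|c| * L); split => // y z xy xz.
by rewrite -mulrBr normrM -mulrA ler_wpM2l// Hr.
Qed.

(** Chain rule. The factor t / 2 halves the slope bound [2 * D], so [D ^+ 2] takes the place of
    [E t], a quarter of the squared slope. *)
Lemma slope_expR_half (g : T -> R) x (D t : R) : 0 <= t -> 0 <= D ->
  slope_bound g x (2 * D) ->
  (slope rho (fun y => expR (t * g y / 2)) x *
   slope rho (fun y => expR (t * g y / 2)) x
   <= (t ^+ 2 * D ^+ 2 * expR (t * g x))%:E)%E.
Proof.
move=> t0 D0 H.
have E : (fun y => expR (t * g y / 2)) = expR \o (fun y => t / 2 * g y).
  by apply/funext => y /=; congr expR; ring.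
have t20 : 0 <= t / 2 by lra.
have H1 := slope_bound_scale _ _ _ _ t20 H.
have G0 : 0 <= t / 2 * (2 * D) by apply: mulr_ge0 => //; lra.
have := slope_sqr_le _ _ _ _ (slope_bound_expR _ _ _ G0 H1).
rewrite -E => /(_ ltac:(by rewrite mulr_ge0 ?expR_ge0)).
suff -> : (t / 2 * (2 * D) * expR (t / 2 * g x)) ^+ 2 =
   t ^+ 2 * D ^+ 2 * expR (t * g x) by [].
by rewrite exprMn -expRM_natl; congr (_ * expR _); field.
Qed.

Lemma sqr_lipschitz_dist (m : T -> R) x y : (forall x, 0 <= m x) ->
  (forall x y, `|m x - m y| <= rho x y) ->
  `|m x ^+ 2 - m y ^+ 2| <= rho x y * (m x + m y).
Proof.
move=> m0 ml; rewrite subr_sqr normrM; apply: ler_pM => //.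
by rewrite ger0_norm ?addr_ge0.
Qed.

Lemma slope_bound_sqr (m : T -> R) x : (forall x, 0 <= m x) ->
  (forall x y, `|m x - m y| <= rho x y) ->
  slope_bound (fun y => m y ^+ 2) x (2 * m x).
Proof.
move=> m0 ml e e0; exists e => // y ye.
apply: le_trans (sqr_lipschitz_dist _ x y m0 ml) _.
rewrite mulrC ler_wpM2r ?metric_ge0//.
have := ml x y; rewrite ler_norml => /andP[]; lra.
Qed.

Lemma sqr_lipschitz_ball (m : T -> R) x y z : (forall x, 0 <= m x) ->
  (forall x y, `|m x - m y| <= rho x y) ->
  rho x y < 1 -> rho x z < 1 ->
  `|m y ^+ 2 - m z ^+ 2| <= (2 * (m x + 1)) * rho y z.
Proof.
move=> m0 ml xy xz; apply: le_trans (sqr_lipschitz_dist _ y z m0 ml) _.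
rewrite mulrC ler_wpM2r ?metric_ge0//.
have := ml x y; have := ml x z; rewrite !ler_norml => /andP[? ?] /andP[? ?]; lra.
Qed.

Lemma slope_boundN (f : T -> R) x G :
  slope_bound f x G -> slope_bound (fun y => - f y) x G.
Proof.
move=> H e e0; have [r r0 Hr] := H e e0; exists r => // y yr.
by rewrite -opprD normrN; exact: Hr.
Qed.

Lemma slope_boundDl (f : T -> R) x G c :
  slope_bound f x G -> slope_bound (fun y => c + f y) x G.
Proof.
move=> H e e0; have [r r0 Hr] := H e e0; exists r => // y yr.
by rewrite opprD addrACA subrr add0r; exact: Hr.
Qed.

Lemma common_radius (I : finType) (P : I -> R -> Prop) :
  (forall i, exists2 r, 0 < r & P i r) ->
  (forall i r r', r' <= r -> P i r -> P i r') ->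
  exists2 r, 0 < r & forall i, P i r.
Proof.
move=> H mono.
suff [r r0 Hr] : exists2 r, 0 < r & {in enum I, forall i, P i r}.
  by exists r => // i; apply: Hr; rewrite mem_enum.
elim: (enum I) => [|i s [r r0 Hr]]; first by exists 1.
have [r' r'0 Hr'] := H i; exists (Num.min r r'); first by rewrite lt_min r0.
move=> j; rewrite inE => /orP[/eqP ->|js].
  by apply: mono Hr'; rewrite ge_min lexx orbT.
by apply: mono (Hr j js); rewrite ge_min lexx.
Qed.

Section finite_maximum.
Variables (I : finType) (f : I -> T -> R) (F : T -> R).
Hypotheses (fF : forall i x, f i x <= F x) (Ff : forall x, exists i, F x = f i x).

(** Near x, an index inactive at x cannot lift the maximum above F x, and an active one changes at a
    rate at most G. In the other direction, F x - F y is bounded through an index active at x. *)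
Lemma slope_bound_max (Gi : I -> R) (G : R) x : (forall i, 0 <= Gi i) ->
  (forall i, slope_bound (f i) x (Gi i)) ->
  (forall i, f i x = F x -> Gi i <= G) -> slope_bound F x G.
Proof.
move=> Gi0 H GG e e0.
(* The second condition shrinks the ball until the gap F x - f i x of each inactive index cannot be
   closed inside it. *)
have [r r0 Hr] : exists2 r, 0 < r & forall i,
    (forall y, rho x y < r -> `|f i x - f i y| <= (Gi i + e) * rho x y) /\
    (f i x < F x -> (Gi i + e) * r <= F x - f i x).
  apply: common_radius => [i|i r r' r'r [H1 H2]]; last first.
    split=> [y yr|/H2]; first by apply: H1; exact: lt_le_trans r'r.
    by apply: le_trans; rewrite ler_wpM2l// addr_ge0// ltW.
  have [r r0 Hr] := H i e e0.
  have [fi|fi] := ltP (f i x) (F x); last by exists r.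
  have Ge : 0 < Gi i + e by apply: ltr_wpDl.
  exists (Num.min r ((F x - f i x) / (Gi i + e))).
    by rewrite lt_min r0 divr_gt0// subr_gt0.
  split=> [y yr|_].
    by apply: Hr; apply: lt_le_trans yr _; rewrite ge_min lexx.
  by rewrite -ler_pdivlMl// mulrC ge_min lexx orbT.
exists r => // y yr; have y0 := metric_ge0 x y.
have [i Fi] := Ff y; have [j Fj] := Ff x.
have [Hi1 Hi2] := Hr i; have [Hj1 _] := Hr j.
have := Hi1 _ yr; have := Hj1 _ yr; have := fF j y; have := fF i x.
have Gj : Gi j <= G by apply: GG.
rewrite !ler_norml => fiF fjF /andP[j1 j2] /andP[i1 i2].
have Gj' : (Gi j + e) * rho x y <= (G + e) * rho x y by rewrite ler_wpM2r ?lerD2r.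
apply/andP; split; last lra.
have [fi|fi] := ltP (f i x) (F x).
  have := Hi2 fi; have := Gi0 i.
  have : (Gi i + e) * rho x y <= (Gi i + e) * r.
    by apply: ler_wpM2l; [rewrite addr_ge0// ltW|exact: ltW].
  have : 0 <= (Gi j + e) * rho x y by rewrite mulr_ge0// addr_ge0// ltW.
  lra.
have Gi' : Gi i <= G by apply: GG; apply/eqP; rewrite eq_le fiF.
have : (Gi i + e) * rho x y <= (G + e) * rho x y by rewrite ler_wpM2r ?lerD2r.
lra.
Qed.

Lemma lipschitz_max (L : R) y z :
  (forall i, `|f i y - f i z| <= L * rho y z) -> `|F y - F z| <= L * rho y z.
Proof.
move=> H; have [i Fi] := Ff y; have [j Fj] := Ff z.
have := H i; have := H j; have := fF j y; have := fF i z.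
by rewrite !ler_norml => ? ? /andP[? ?] /andP[? ?]; apply/andP; split; lra.
Qed.

End finite_maximum.

Hypothesis bor : borel_sigma rho.

Lemma measurable_rho_open (A : set T) : rho_open rho A -> measurable A.
Proof. by move=> oA; rewrite bor; exact: sub_sigma_algebra. Qed.

Lemma measurable_metric u : measurable_fun setT (rho ^~ u).
Proof.
apply: (measurability _ (RGenInftyO.measurableE R)) => _ [_ [c ->] <-].
rewrite setTI; apply: measurable_rho_open => x /=; rewrite in_itv /= => xc.
exists (c - rho x u); first by rewrite subr_gt0.
move=> y /= xy; rewrite in_itv /=.
by have := metric_triangle y x u; rewrite (metricC y x); lra.
Qed.

Lemma dense_sequence : rho_separable rho ->
  exists u : nat -> T, forall x (e : R), 0 < e -> exists n, rho x (u n) < e.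
Proof.
move=> [D [cD dD]].
have [D0|[u]] := pfcard_geP cD.
  by have [y] := dD point 1 ltr01; rewrite D0.
exists u => x e e0; have [y Dy xy] := dD x e e0.
by have [n _ un] := 'surj_u Dy; exists n; rewrite un.
Qed.

(** By density, rho x y < c holds exactly when some u n has rho x (u n) + rho y (u n) < c. This is a
    countable union of sets measurable for the product sigma-algebra. *)
Lemma measurable_metric2 : rho_separable rho ->
  measurable_fun setT (fun z : T * T => rho z.1 z.2).
Proof.
move=> /dense_sequence[u du].
apply: (measurability _ (RGenInftyO.measurableE R)) => _ [_ [c ->] <-].
rewrite setTI.
have -> : (fun z => rho z.1 z.2) @^-1` `]-oo, c[ =
  \bigcup_n ((fun z : T * T => rho z.1 (u n) + rho z.2 (u n)) @^-1` `]-oo, c[).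
  apply/seteqP; split => [[x y] /=|[x y] [n _] /=]; rewrite !in_itv /=.
    move=> xyc; have [n xu] := du x ((c - rho x y) / 2) ltac:(lra).
    exists n => //=; rewrite in_itv /=; have := metric_triangle y x (u n).
    rewrite (metricC y x); lra.
  by have := metric_triangle x (u n) y; rewrite (metricC y (u n)); lra.
apply: bigcupT_measurable => n.
rewrite -[X in measurable X]setTI.
suff : measurable_fun setT (fun z : T * T => rho z.1 (u n) + rho z.2 (u n)).
  by apply => //; exact: measurable_itv.
apply: measurable_funD.
  by apply: (measurableT_comp (measurable_metric (u n))); exact: measurable_fst.
by apply: (measurableT_comp (measurable_metric (u n))); exact: measurable_snd.
Qed.

End metric_space.

(** * Exponential integrability of the truncated squared distance *)

Section instances.
Context {d : measure_display} {T : measurableType d} {R : realType}.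
Variables (rho : T -> T -> R) (mu : probability T R) (C : R).
Hypotheses (met : is_metric rho) (bor : borel_sigma rho).
Hypotheses (C0 : 0 < C) (lsi : LSI rho mu C).

Lemma measurable_metric_sqr u : measurable_fun setT (fun x => rho x u ^+ 2).
Proof. by apply: measurable_funX; exact: measurable_metric. Qed.

(** A finite second moment does not depend on the base point, as (a + b)^2 <= 2 (a^2 + b^2). *)
Lemma integrable_metric_sqr (nu : probability T R) u v :
  (\int[nu]_x ((rho x u) ^+ 2)%:E < +oo)%E ->
  nu.-integrable setT (EFin \o (fun x => rho x v ^+ 2)).
Proof.
move=> fin.
have iu : nu.-integrable setT (EFin \o (fun x => rho x u ^+ 2)).
  apply/integrableP; split; first exact/measurable_EFinP/measurable_metric_sqr.
  by under eq_integral do rewrite /= ger0_norm ?sqr_ge0//.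
have i1 : nu.-integrable setT (EFin \o (fun=> rho u v ^+ 2)).
  exact: finite_measure_integrable_cst.
apply: (@integrable_le_scale _ _ _ _ _ (fun x => rho x u ^+ 2 + rho u v ^+ 2) 2).
- exact: measurable_metric_sqr.
- exact: (integrableD _ iu i1).
- move=> x; rewrite ger0_norm ?sqr_ge0//.
  have := metric_triangle _ met x u v; have := metric_ge0 _ met x v.
  by have := sqr_ge0 (rho x u - rho u v); nra.
Qed.

Section truncated_distance.
Variables (u : T) (k : R).
Hypothesis k0 : 0 <= k.

Let m x := Num.min (rho x u) k.

Let m_ge0 x : 0 <= m x.
Proof. by rewrite /m le_min k0 metric_ge0. Qed.

Let m_lip x y : `|m x - m y| <= rho x y.
Proof.
have := metric_lip _ met u x y; rewrite /m !ler_norml /Num.min.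
by case: ifPn => ?; case: ifPn => ? /andP[? ?]; apply/andP; split; lra.
Qed.

Let m_lek x : m x <= k. Proof. by rewrite /m ge_min lexx orbT. Qed.

Let mm : measurable_fun setT (fun x => m x ^+ 2).
Proof.
apply: measurable_funX; apply: measurable_minr => //.
exact: measurable_metric.
Qed.

(** Take h_t = min(rho, k)^2 / (1 + C t) up to s = 1 / C, where s h_s = min(rho, k)^2 / (2 C).
    Truncation makes h bounded, while the resulting estimate is free of k. *)
Lemma ln_expR_truncated_distance : (\int[mu]_x ((rho x u) ^+ 2)%:E < +oo)%E ->
  ln (\int[mu]_x expR ((Num.min (rho x u) k) ^+ 2 / (2 * C)))
  <= (\int[mu]_x (rho x u ^+ 2)) / C.
Proof.
move=> fin; have iu := integrable_metric_sqr _ u u fin.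
have mle x : m x ^+ 2 <= k ^+ 2 by rewrite ler_sqr ?nnegrE.
pose c (t : R) := (1 + C * t)^-1.
have c0 t : 0 <= t -> 0 < c t.
  by move=> t0; rewrite invr_gt0 ltr_wpDr// mulr_ge0// ltW.
pose h t x := c t * m x ^+ 2.
pose E t x := (c t * m x) ^+ 2.
have im : mu.-integrable setT (EFin \o (fun x => m x ^+ 2)).
  apply: (@integrable_bounded _ _ _ _ _ (k ^+ 2)) => // x.
  by rewrite ger0_norm ?sqr_ge0.
have s0 : 0 < C^-1 by rewrite invr_gt0.
have c01 t : 0 <= t <= C^-1 -> 0 < c t <= 1.
  move=> /andP[t0 ts]; rewrite c0//= invf_le1.
    by rewrite lerDl mulr_ge0// ltW.
  by rewrite ltr_wpDr// mulr_ge0// ltW.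
have hm t x : 0 <= t <= C^-1 -> 0 <= h t x <= m x ^+ 2.
  move=> /c01/andP[ct0 ct1]; have := sqr_ge0 (m x); rewrite /h; nra.
have h0 x : h 0 x = m x ^+ 2 by rewrite /h /c mulr0 addr0 invr1 mul1r.
have := @ln_Rintegral_hamilton_jacobi _ _ _ rho mu C C0 lsi h E
  (fun x => m x ^+ 2) C^-1 (k ^+ 2) 0 s0 (sqr_ge0 _) (lexx _).
have -> : \int[mu]_x expR (C^-1 * h C^-1 x) =
   \int[mu]_x expR (m x ^+ 2 / (2 * C)).
  apply: eq_Rintegral => x _; congr expR; rewrite /h /c divff ?gt_eqF//.
  by field; rewrite gt_eqF.
have -> : \int[mu]_x h 0 x = \int[mu]_x (m x ^+ 2).
  by apply: eq_Rintegral => x _; exact: h0.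
move=> H; apply: le_trans (_ : (\int[mu]_x (m x ^+ 2)) / C <= _); last first.
  apply: ler_wpM2r; first exact: ltW.
  apply: le_Rintegral => // x _.
  rewrite ler_sqr ?nnegrE ?m_ge0//; first by rewrite /m ge_min lexx.
  exact: metric_ge0.
rewrite ler_pdivlMr// -[X in _ * X <= _]invrK; apply: H => //.
- by move=> t _; apply: measurable_funM.
- move=> t _; apply: measurable_funX; apply: measurable_funM => //.
  by apply: measurable_minr => //; exact: measurable_metric.
- by move=> t x /hm => /(_ x)/andP[? ?]; rewrite ger0_norm.
- by move=> t x /hm => /(_ x)/andP[? ?]; apply: (le_trans _ (mle x)).
- by move=> t x _; exact: sqr_ge0.
- move=> t x /c01/andP[ct0 ct1]; rewrite /E exprMn.
  by rewrite ler_piMl ?sqr_ge0// expr_le1// ltW.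
- by move=> t x /hm => /(_ x)/andP[? ?]; rewrite h0.
(* Since c a - c b = C (b - a) c a c b >= C (b - a) (c b)^2, the decrease holds with K = 0. *)
- move=> a b x a0 ab bs; rewrite mul0r subr0 /E /h.
  have ca : 0 < c a by exact: c0.
  have cb : 0 < c b by apply: c0; exact: le_trans ab.
  have cE : c a - c b = C * (b - a) * (c a * c b).
    have ? : 1 + C * a != 0 by rewrite -invr_eq0 gt_eqF.
    have ? : 1 + C * b != 0 by rewrite -invr_eq0 gt_eqF.
    by rewrite /c; field; apply/andP.
  have cba : c b <= c a.
    by rewrite -subr_ge0 cE !mulr_ge0 ?subr_ge0// ltW.
  have : 0 <= C * (b - a) * (c b * m x ^+ 2) * (c a - c b).
    by rewrite !mulr_ge0 ?subr_ge0 ?sqr_ge0// ltW.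
  move: cE; nra.
- move=> t ts.
  have t0 : 0 <= t by case/andP: ts.
  have /andP[ct0 ct1] := c01 _ ts.
  rewrite (_ : (fun x => _) = expR \o (fun x => t / 2 * c t * m x ^+ 2)); last first.
    by apply/funext => x /=; congr expR; rewrite /h; ring.
  apply: (loc_lipschitz_expR rho _ (t / 2 * c t * k ^+ 2)) => [x|].
    by apply: ler_wpM2l; rewrite ?mulr_ge0// ltW.
  apply: loc_lipschitz_scale => x; exists 1, (2 * (m x + 1)); split => // y z xy xz.
  exact: sqr_lipschitz_ball.
- move=> t x ts; have /andP[t0 _] := ts; have /andP[ct0 _] := c01 _ ts.
  apply: slope_expR_half => //; first by rewrite mulr_ge0// ltW.
  rewrite mulrCA; apply: slope_bound_scale => //; first exact: ltW.
  exact: slope_bound_sqr.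
Qed.

End truncated_distance.
End instances.

(** * Finite maxima of parabolas as a Hamilton-Jacobi family *)

Lemma bigmax_attained {R : realType} (I : finType) (x0 : R) (f : I -> R) :
  \big[Num.max/x0]_i f i = x0 \/ exists i, \big[Num.max/x0]_i f i = f i.
Proof.
apply: (big_ind (fun v => v = x0 \/ exists i, v = f i)).
- by left.
- by move=> a b ha hb; rewrite /Num.max; case: ifP.
- by move=> i _; right; exists i.
Qed.

Lemma measurable_bigmax {d : measure_display} {T : measurableType d}
  {R : realType} (I : finType) (f0 : T -> R) (f : I -> T -> R) :
  measurable_fun setT f0 -> (forall i, measurable_fun setT (f i)) ->
  measurable_fun setT (fun x => \big[Num.max/f0 x]_i f i x).
Proof.
move=> m0 mf; elim: (index_enum I) => [|i s IH].
  by under eq_fun do rewrite big_nil.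
under eq_fun do rewrite big_cons.
exact: measurable_maxr.
Qed.

Section parabola_max.
Context {d : measure_display} {T : measurableType d} {R : realType}.
Variables (rho : T -> T -> R) (mu : probability T R) (C : R).
Hypotheses (met : is_metric rho) (bor : borel_sigma rho).
Variables (I : finType) (i0 : I) (u : I -> T) (w : I -> R).

(** This is h_t with b = 1 / (1 - C t). The parabola of [i0] is the base value of the maximum, since
    the reals have no least element. *)
Definition parabola_max (b : R) (x : T) :=
  \big[Num.max/w i0 - b * rho x (u i0) ^+ 2]_i (w i - b * rho x (u i) ^+ 2).

Lemma parabola_max_ge b i x : w i - b * rho x (u i) ^+ 2 <= parabola_max b x.
Proof. exact: (le_bigmax _ (fun i => w i - b * rho x (u i) ^+ 2)). Qed.

Lemma parabola_max_attained b x :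
  exists i, parabola_max b x = w i - b * rho x (u i) ^+ 2.
Proof.
rewrite /parabola_max.
by case: (bigmax_attained I (w i0 - b * rho x (u i0) ^+ 2)
  (fun i => w i - b * rho x (u i) ^+ 2)) => [->|//]; exists i0.
Qed.

Lemma measurable_parabola b i :
  measurable_fun setT (fun x => w i - b * rho x (u i) ^+ 2).
Proof.
apply: measurable_funB => //; apply: measurable_funM => //.
exact: measurable_metric_sqr.
Qed.

Lemma measurable_parabola_max b : measurable_fun setT (parabola_max b).
Proof.
by apply: measurable_bigmax => [|i]; exact: measurable_parabola.
Qed.

(* Where several parabolas attain the maximum, the steepest one governs the slope. *)
Definition active_sqr (b : R) (x : T) :=
  \big[Num.max/0]_i (if w i - b * rho x (u i) ^+ 2 == parabola_max b x
                     then rho x (u i) ^+ 2 else 0).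

Lemma active_sqr_ge0 b x : 0 <= active_sqr b x.
Proof. exact: bigmax_ge_id. Qed.

Lemma active_sqr_ge b x i : w i - b * rho x (u i) ^+ 2 = parabola_max b x ->
  rho x (u i) ^+ 2 <= active_sqr b x.
Proof.
move=> Hi; have := le_bigmax 0 (fun i => if w i - b * rho x (u i) ^+ 2 ==
  parabola_max b x then rho x (u i) ^+ 2 else 0) i.
by rewrite {1}Hi eqxx.
Qed.

Lemma active_sqr_attained b x : exists i,
  parabola_max b x = w i - b * rho x (u i) ^+ 2 /\
  active_sqr b x = rho x (u i) ^+ 2.
Proof.
have [i Hi] := parabola_max_attained b x.
(* If the maximum is its default 0, every active index has squared distance at most 0, so any of
   them attains it. *)
have zero_case : active_sqr b x = 0 -> exists i,
    parabola_max b x = w i - b * rho x (u i) ^+ 2 /\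
    active_sqr b x = rho x (u i) ^+ 2.
  move=> a0; exists i; split => //; apply/eqP; rewrite eq_le.
  by rewrite [X in X <= _]a0 sqr_ge0 active_sqr_ge.
have [|[j]] := bigmax_attained I 0 (fun i => if w i - b * rho x (u i) ^+ 2 ==
  parabola_max b x then rho x (u i) ^+ 2 else 0); rewrite -/(active_sqr b x).
  exact: zero_case.
by case: eqP => [Hj aj|_ //]; exists j.
Qed.

Lemma measurable_active_sqr b : measurable_fun setT (active_sqr b).
Proof.
apply: measurable_bigmax => // i; apply: measurable_fun_ifT => //.
  apply: measurable_fun_eqr; first exact: measurable_parabola.
  exact: measurable_parabola_max.
exact: measurable_metric_sqr.
Qed.

Let W := \sum_i `|w i|.
Let S x := \sum_i rho x (u i) ^+ 2.

Let le_W i : `|w i| <= W.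
Proof. by rewrite /W (bigD1 i)//= lerDl sumr_ge0. Qed.

Let le_S x i : rho x (u i) ^+ 2 <= S x.
Proof. by rewrite /S (bigD1 i)//= lerDl sumr_ge0// => j _; exact: sqr_ge0. Qed.

Let S_ge0 x : 0 <= S x.
Proof. by apply: sumr_ge0 => j _; exact: sqr_ge0. Qed.

Lemma parabola_max_le b x : 0 <= b -> parabola_max b x <= W.
Proof.
move=> b0; have [i ->] := parabola_max_attained b x.
have := mulr_ge0 b0 (sqr_ge0 (rho x (u i))).
by have := le_W i; have := ler_norm (w i); lra.
Qed.

Lemma parabola_max_norm b x : 0 <= b ->
  `|parabola_max b x| <= W + b * S x.
Proof.
move=> b0; have [i ->] := parabola_max_attained b x.
apply: le_trans (ler_normB _ _) _; apply: lerD; first exact: le_W.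
rewrite ger0_norm; first exact: ler_wpM2l.
by rewrite mulr_ge0 ?sqr_ge0.
Qed.

Lemma active_sqr_le b x : active_sqr b x <= S x.
Proof. by have [i [_ ->]] := active_sqr_attained b x. Qed.

(** An active parabola has slope at most 2 b rho x (u i). The square root form makes the square of
    half the bound equal to b^2 times [active_sqr]. *)
Lemma slope_bound_parabola_max b x : 0 <= b ->
  slope_bound rho (parabola_max b) x (2 * Num.sqrt (b ^+ 2 * active_sqr b x)).
Proof.
move=> b0.
apply: (slope_bound_max _ met I (fun i x => w i - b * rho x (u i) ^+ 2) _
   (parabola_max_ge b) (parabola_max_attained b)
   (fun i => b * (2 * rho x (u i)))).
- by move=> i; rewrite !mulr_ge0// metric_ge0.
- move=> i; apply: slope_boundDl; apply: slope_boundN.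
  apply: slope_bound_scale => //; apply: slope_bound_sqr => // y.
    exact: metric_ge0.
  by move=> z; exact: metric_lip.
- move=> i Hi; rewrite mulrCA ler_pM2l//.
  rewrite -[leLHS]ger0_norm ?mulr_ge0 ?metric_ge0// -sqrtr_sqr exprMn.
  by rewrite ler_wsqrtr// ler_wpM2l ?sqr_ge0// active_sqr_ge.
Qed.

Lemma loc_lipschitz_parabola_max b : 0 <= b ->
  loc_lipschitz rho (parabola_max b).
Proof.
move=> b0 x; exists 1, (b * \sum_i (2 * (rho x (u i) + 1))); split => // y z xy xz.
apply: (lipschitz_max _ I (fun i x => w i - b * rho x (u i) ^+ 2)).
- exact: parabola_max_ge.
- exact: parabola_max_attained.
- move=> i.
  have -> : w i - b * rho y (u i) ^+ 2 - (w i - b * rho z (u i) ^+ 2) =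
    b * (rho z (u i) ^+ 2 - rho y (u i) ^+ 2) by ring.
  rewrite normrM ger0_norm// -mulrA distrC; apply: ler_wpM2l => //.
  apply: le_trans (sqr_lipschitz_ball _ met (fun v => rho v (u i)) x y z
    (fun v => metric_ge0 _ met v _) (metric_lip _ met (u i)) xy xz) _.
  apply: ler_wpM2r; first exact: metric_ge0.
  rewrite [leRHS](bigD1 i)//= lerDl; apply: sumr_ge0 => j _.
  by rewrite mulr_ge0// addr_ge0// metric_ge0.
Qed.

Hypotheses (C0 : 0 < C) (lsi : LSI rho mu C).
Hypothesis mu2 : forall v, mu.-integrable setT (EFin \o (fun x => rho x v ^+ 2)).

(** The coefficient b(t) = 1 / (1 - C t) grows from b(0) = 1 to b(s) = 4 at s = 3 / (4 C). *)
Lemma ln_expR_parabola_max :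
  ln (\int[mu]_x expR (3 / (4 * C) * parabola_max 4 x)) / (3 / (4 * C)) <=
  \int[mu]_x parabola_max 1 x.
Proof.
pose b (t : R) := (1 - C * t)^-1; pose s := 3 / (4 * C).
have s0 : 0 < s by rewrite /s divr_gt0// mulr_gt0.
have Cs : C * s = 3 / 4 by rewrite /s; field; rewrite gt_eqF.
have bs : b s = 4 by rewrite /b Cs; field.
have b0 : b 0 = 1 by rewrite /b mulr0 subr0 invr1.
have den t : 0 <= t <= s -> 1 / 4 <= 1 - C * t <= 1.
  move=> /andP[t0 ts]; have := ler_wpM2l (ltW C0) ts; rewrite Cs => ?.
  by have := mulr_ge0 (ltW C0) t0; lra.
have bt t : 0 <= t <= s -> 1 <= b t <= 4.
  move=> /den/andP[d1 d2].
  have d0 : 0 < 1 - C * t by lra.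
  have E : b t * (1 - C * t) = 1 by rewrite /b mulVf// gt_eqF.
  have : 0 < b t by rewrite invr_gt0.
  by move=> ?; apply/andP; split; nra.
have bt0 t : 0 <= t <= s -> 0 <= b t by move=> /bt/andP[? _]; lra.
pose h t x := parabola_max (b t) x.
pose E t x := b t ^+ 2 * active_sqr (b t) x.
have iS : mu.-integrable setT (EFin \o S).
  rewrite (_ : EFin \o S = fun x => (\sum_i (rho x (u i) ^+ 2)%:E)%E).
    by apply: integrable_sum => // i _; exact: mu2.
  by apply/funext => x /=; rewrite sumEFin.
(* As b(t) <= 4, this dominates both |h_t| and E_t, whose factor is b(t)^2 <= 16. *)
pose Q x := W + 16 * S x.
have iQ : mu.-integrable setT (EFin \o Q).
  have i1 : mu.-integrable setT (EFin \o (fun=> W)).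
    exact: finite_measure_integrable_cst.
  exact: (integrableD measurableT i1 (integrableZl measurableT 16 iS)).
have W0 : 0 <= W by apply: sumr_ge0.
have := @ln_Rintegral_hamilton_jacobi _ _ _ rho mu C C0 lsi h E
  Q s W (4 * C ^+ 2) s0 W0.
rewrite /h bs b0; apply => //.
- by rewrite mulr_ge0 ?sqr_ge0.
- by move=> t _; exact: measurable_parabola_max.
- move=> t _; apply: measurable_funM => //; exact: measurable_active_sqr.
- move=> t x ts; apply: le_trans (parabola_max_norm _ _ (bt0 _ ts)) _.
  by rewrite lerD2l; have := S_ge0 x; have /andP[] := bt _ ts; nra.
- by move=> t x ts; apply: parabola_max_le; exact: bt0.
- by move=> t x ts; rewrite mulr_ge0 ?sqr_ge0 ?active_sqr_ge0.
- move=> t x ts; have /andP[b1 b4] := bt _ ts.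
  have : E t x <= 16 * S x.
    apply: ler_pM; rewrite ?sqr_ge0 ?active_sqr_ge0 ?active_sqr_le//; nra.
  by rewrite /Q; lra.
- move=> t x ts; have /andP[b1 b4] := bt _ ts.
  have [i ->] := parabola_max_attained (b t) x.
  apply: le_trans (parabola_max_ge 1 i x).
  by rewrite lerD2l lerN2 ler_wpM2r ?sqr_ge0.
(* Fix the steepest index active at time v; its parabola at time p is a lower bound for h_p. It
   remains to compare coefficients: b v - b p = C (v - p) b v b p, and replacing b p by b v costs a
   second-order term, covered by K = 4 C^2 because b p <= 4. *)
- move=> p v x p0 pv vs.
  have vr : 0 <= v <= s by rewrite (le_trans p0).
  have pr : 0 <= p <= s by rewrite p0 (le_trans pv).
  have [i [-> Ei]] := active_sqr_attained (b v) x.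
  rewrite /E Ei; apply: le_trans (_ : w i - b p * rho x (u i) ^+ 2 -
    (C - 4 * C ^+ 2 * (v - p)) * (v - p) * (b v ^+ 2 * rho x (u i) ^+ 2) <= _);
    last by rewrite lerD2r parabola_max_ge.
  suff : b p + (C - 4 * C ^+ 2 * (v - p)) * (v - p) * b v ^+ 2 <= b v.
    by move=> H; have := ler_wpM2r (sqr_ge0 (rho x (u i))) H; lra.
  have /andP[bp1 bp4] := bt _ pr; have /andP[bv1 bv4] := bt _ vr.
  have /andP[dp1 dp2] := den _ pr; have /andP[dv1 dv2] := den _ vr.
  have Ep : b p * (1 - C * p) = 1 by rewrite /b mulVf// gt_eqF//; lra.
  have Ev : b v * (1 - C * v) = 1 by rewrite /b mulVf// gt_eqF//; lra.
  have E1 : b v - b p = b v * b p * (C * (v - p)).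
    transitivity (b v * (b p * (1 - C * p)) - b p * (b v * (1 - C * v))).
      by rewrite Ep Ev !mulr1.
    by ring.
  have E2 : b v = b p + b v * b p * (C * (v - p)) by lra.
  rewrite -subr_ge0.
  have -> : b v - (b p + (C - 4 * C ^+ 2 * (v - p)) * (v - p) * b v ^+ 2) =
    (C * (v - p)) ^+ 2 * b v ^+ 2 * (4 - b p).
    have -> : b v - (b p + (C - 4 * C ^+ 2 * (v - p)) * (v - p) * b v ^+ 2) =
      (b v - b p) - C * (v - p) * b v * b v + 4 * (C * (v - p)) ^+ 2 * b v ^+ 2.
      by ring.
    rewrite E1; rewrite [X in _ - C * (v - p) * b v * X]E2; ring.
  apply: mulr_ge0; last by rewrite subr_ge0.
  by apply: mulr_ge0; exact: sqr_ge0.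
- move=> t ts.
  have t0 : 0 <= t by case/andP: ts.
  rewrite (_ : (fun x => _) = expR \o (fun x => t / 2 * parabola_max (b t) x)); last first.
    by apply/funext => x /=; congr expR; ring.
  apply: (loc_lipschitz_expR rho _ (t / 2 * W)) => [x|].
    by rewrite ler_wpM2l ?divr_ge0// parabola_max_le// bt0.
  by apply: loc_lipschitz_scale; apply: loc_lipschitz_parabola_max; exact: bt0.
- move=> t x ts; have t0 : 0 <= t by case/andP: ts.
  have := slope_expR_half rho met _ x _ t t0 (sqrtr_ge0 _)
    (slope_bound_parabola_max _ x (bt0 _ ts)).
  by rewrite sqr_sqrtr// mulr_ge0 ?sqr_ge0 ?active_sqr_ge0.
Qed.

End parabola_max.

(** * Gibbs' variational principle *)

Section gibbs.
Context {d : measure_display} {T : measurableType d} {R : realType}.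

(** Positive and negative parts are compared separately, which allows infinite integrals such as
    that of the logarithm of the density. *)
Lemma le_integral_measurable (nu : probability T R) (f g : T -> \bar R) :
  measurable_fun setT f -> measurable_fun setT g -> (forall x, f x <= g x)%E ->
  (\int[nu]_x f x <= \int[nu]_x g x)%E.
Proof.
move=> mf mg fg; rewrite integralE [leRHS]integralE leeB//.
  apply: ge0_le_integral => //; [exact: measurable_funepos|exact: measurable_funepos|].
  by move=> x _; apply: (@funepos_le _ _ setT) => [y _|]; rewrite ?inE.
apply: ge0_le_integral => //; [exact: measurable_funeneg|exact: measurable_funeneg|].
by move=> x _; apply: (@funeneg_le _ _ setT) => [y _|]; rewrite ?inE.
Qed.

(** With r the density of nu, 1 + y <= e^y at y = g - ln Z - ln r bounds ln r below by the
    integrable [M]. The exponential [k] has nu-integral at most 1, which the constant 1 in [M]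
    compensates. *)
Lemma gibbs_variational (nu mu : probability T R) (g : T -> R) :
  nu `<< mu -> nu.-integrable setT (EFin \o g) ->
  mu.-integrable setT (EFin \o (expR \o g)) ->
  0 < \int[mu]_x expR (g x) ->
  ((\int[nu]_x g x - ln (\int[mu]_x expR (g x)))%:E <= relEnt nu mu)%E.
Proof.
move=> numu ig ieg; set Z := \int[mu]_x expR (g x) => Z0.
rewrite /relEnt; case: pselect => // numu'.
pose RN := Radon_Nikodym (charge_of_finite_measure nu) mu.
have fRN x : RN x \is a fin_num by exact: Radon_Nikodym_fin_num.
have iRN : mu.-integrable setT RN by exact: Radon_Nikodym_integrable.
have mRN : measurable_fun setT RN by exact: measurable_int iRN.
pose r x := fine (RN x).
have mr : measurable_fun setT r by exact: measurableT_comp.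
have mg : measurable_fun setT g by apply/measurable_EFinP; exact: measurable_int ig.
pose N := [set x | r x <= 0].
have mN : measurable N.
  by rewrite -[N]setTI; apply: measurable_fun_le.
have nuN : nu N = 0.
  apply/eqP; rewrite eq_le measure_ge0 andbT.
  have -> : nu N = charge_of_finite_measure nu N by [].
  rewrite (@Radon_Nikodym_integral _ _ _ (charge_of_finite_measure nu) mu N numu mN)
    -[leRHS](integral0 mu N).
  apply: le_integral => //.
  - exact: (integrableS measurableT mN (@subsetT _ _) iRN).
  - exact: integrable0.
  - by move=> x; rewrite inE /N /= -lee_fin /r fineK.
(* The value 0 on the nu-null set [N] gives k r <= e^g / Z at every point where r is the density. *)
pose k x := if 0 < r x then expR (g x - ln Z - ln (r x)) else 0.
have k0 x : 0 <= k x by rewrite /k; case: ifPn => // _; exact: expR_ge0.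
have mln : measurable_fun setT (fun x => ln (r x)).
  exact: (measurableT_comp (@measurable_ln R) mr).
have mk : measurable_fun setT k.
  apply: measurable_fun_ifT => //; first exact: measurable_fun_ltr.
  apply: measurableT_comp => //; apply: measurable_funB => //.
  exact: measurable_funB.
have iq := integrableZl measurableT Z^-1 ieg.
have Ik : (\int[nu]_x (k x)%:E <= 1)%E.
  rewrite -(Radon_Nikodym_SigmaFinite.change_of_variables numu)//;
    last exact/measurable_EFinP.
  apply: le_trans (_ : \int[mu]_x (Z^-1 * expR (g x))%:E <= _)%E; last first.
    by rewrite EFin_Rintegral// RintegralZl// mulVf// gt_eqF.
  apply: ae_ge0_le_integral => //.
  - move=> x _; rewrite mule_ge0 ?lee_fin//.
    exact: Radon_Nikodym_SigmaFinite.f_ge0.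
  - apply: emeasurable_funM; first exact/measurable_EFinP.
    exact: measurable_int (Radon_Nikodym_SigmaFinite.f_integrable numu).
  - by move=> x _; rewrite lee_fin mulr_ge0 ?expR_ge0// invr_ge0 ltW.
  - exact: measurable_int iq.
  - apply: filterS (ae_eq_Radon_Nikodym_SigmaFinite numu measurableT).
    move=> x /(_ I) -> _; rewrite -/RN -(fineK (fRN x)) -EFinM lee_fin -/(r x) /k.
    case: ifPn => [rx|_].
      rewrite !expRB !lnK// divfK ?gt_eqF// mulrC.
      by rewrite mulrC.
    by rewrite mul0r mulr_ge0 ?expR_ge0// invr_ge0 ltW.
have ik : nu.-integrable setT (EFin \o k).
  apply/integrableP; split; first exact/measurable_EFinP.
  under eq_integral do rewrite /= ger0_norm//.
  by apply: le_lt_trans Ik _; rewrite ltry.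
pose M x := g x + (1 - ln Z) - k x.
have i1 : nu.-integrable setT (EFin \o (fun=> 1 - ln Z)).
  exact: finite_measure_integrable_cst.
have i2 : nu.-integrable setT (EFin \o (fun x => g x + (1 - ln Z))).
  exact: (integrableD measurableT ig i1).
have iM : nu.-integrable setT (EFin \o M).
  exact: (integrableB measurableT i2 ik).
have mM : measurable_fun setT M by apply/measurable_EFinP; exact: measurable_int iM.
apply: (@le_trans _ _ (\int[nu]_x (M x)%:E)%E).
  rewrite EFin_Rintegral// lee_fin RintegralB// RintegralD// Rintegral1.
  have : \int[nu]_x k x <= 1 by rewrite -lee_fin -EFin_Rintegral.
  lra.
(* On [N] the inequality M <= ln r may fail. The maximum equals ln r outside [N] and dominates [M]
   everywhere. *)
rewrite [leRHS](ae_eq_integral (fun x => (Num.max (M x) (ln (r x)))%:E)) //.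
- apply: le_integral_measurable.
  + exact/measurable_EFinP.
  + by apply/measurable_EFinP; exact: measurable_maxr.
  + by move=> x; rewrite lee_fin le_max lexx.
- exact/measurable_EFinP.
- by apply/measurable_EFinP; exact: measurable_maxr.
- exists N; split => // x /= H; rewrite /N /= leNgt; apply/negP => rx; apply: H => _.
  congr EFin; apply/esym/max_idPr; rewrite /M /k rx.
  have := expR_ge1Dx (g x - ln Z - ln (r x)); lra.
Qed.

End gibbs.

(** * Level sets, finite unions and continuity of measure *)

Section real_level_sets.
Context {d : measure_display} {T : measurableType d} {R : realType}.
Variables (f g : T -> R).
Hypotheses (mf : measurable_fun setT f) (mg : measurable_fun setT g).

Lemma measurable_le_set : measurable [set x | f x <= g x].
Proof. by rewrite -[X in measurable X]setTI; exact: measurable_fun_le. Qed.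

Lemma measurable_lt_set : measurable [set x | f x < g x].
Proof.
rewrite -[X in measurable X]setTI.
exact: (measurable_fun_ltr mf mg measurableT (Y := [set true])).
Qed.

Lemma measurable_eq_set : measurable [set x | f x = g x].
Proof.
have := measurable_fun_eqr mf mg measurableT (Y := [set true]) ltac:(by []).
by rewrite setTI; congr (measurable _); apply/seteqP; split => x /eqP.
Qed.

End real_level_sets.

Section finite_families.
Context {d : measure_display} {T : measurableType d} {R : realType}.
Variable mu : probability T R.

Lemma sum_measure_disjoint (I : finType) (F : I -> set T) :
  (forall i, measurable (F i)) -> trivIset setT F ->
  (\sum_i mu (F i))%E = mu (\bigcup_i F i).
Proof.
move=> mF tF; rewrite measure_fin_bigcup//; last exact: finite_finset.
rewrite (bigfs _ _ (r := index_enum I) (P := xpredT)) ?index_enum_uniq//.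
  by apply: eq_fsbigl; apply/seteqP; split.
by move=> i _; rewrite mem_index_enum.
Qed.

Lemma negligible_finite_union (I : finType) (F : I -> set T) :
  (forall i, mu.-negligible (F i)) -> mu.-negligible (\bigcup_i F i).
Proof.
move=> HF; suff : mu.-negligible [set x | exists2 i, i \in enum I & F i x].
  by apply: negligibleS => x [i _ Fi]; exists i => //; rewrite mem_enum.
elim: (enum I) => [|i s IH].
  by apply: negligibleS (negligible_set0 _) => x [].
apply: negligibleS (negligibleU (HF i) IH) => x [j].
by rewrite inE => /orP[/eqP ->|js] Fj; [left|right; exists j].
Qed.

Lemma exists_measure_gt (F : nat -> set T) (a : \bar R) :
  (forall n, measurable (F n)) -> {homo F : n m / (n <= m)%N >-> (n <= m)%O} ->
  (a < mu (\bigcup_n F n))%E -> exists n, (a < mu (F n))%E.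
Proof.
move=> mF hF; apply: contraPP => H; apply/negP; rewrite -leNgt.
have := nondecreasing_cvg_mu (mu := mu) mF (bigcupT_measurable F mF) hF.
apply: cvge_le.
apply: nearW => n /=; rewrite leNgt; apply/negP => an.
by apply: H; exists n.
Qed.

Lemma exists_measure_lt (F : nat -> set T) (a : \bar R) :
  (forall n, measurable (F n)) -> {homo F : n m / (n <= m)%N >-> (m <= n)%O} ->
  (mu (\bigcap_n F n) < a)%E -> exists n, (mu (F n) < a)%E.
Proof.
move=> mF hF; apply: contraPP => H; apply/negP; rewrite -leNgt.
have F0 : (mu (F 0%N) < +oo)%E.
  by apply: le_lt_trans (probability_le1 mu (mF 0%N)) _; rewrite ltry.
have := nonincreasing_cvg_mu (mu := mu) F0 mF (bigcapT_measurable mF) hF.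
apply: cvge_ge.
apply: nearW => n /=; rewrite leNgt; apply/negP => an.
by apply: H; exists n.
Qed.

Lemma exists_small_tail (f : T -> R) (e : R) : measurable_fun setT f ->
  0 < e -> exists M : R, 0 <= M /\ (mu [set x | M < f x]%R < e%:E)%E.
Proof.
move=> mf e0; pose F n := [set x | n%:R < f x].
have mF n : measurable (F n).
  exact: measurable_lt_set.
have [||n Hn] := @exists_measure_lt F e%:E mF.
- move=> n m nm; apply/subsetPset => x; rewrite /F /=.
  by apply: le_lt_trans; rewrite ler_nat.
- rewrite (_ : \bigcap_n F n = set0) ?measure0// -subset0 => x Fx.
  have := Fx (Num.bound `|f x|) I; rewrite /F /= ltNge => /negP; apply.
  by apply: le_trans (ler_norm _) _; rewrite ltW// archi_boundP.
- by exists n%:R.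
Qed.

End finite_families.

(** * Laguerre cells with prescribed masses *)

Section laguerre_cells.
Context {d : measure_display} {T : measurableType d} {R : realType}.
Variables (I : finType) (c : I -> T -> R).

(** Strict inequalities make the cells disjoint for every weight; the points left over are ties. *)
Definition laguerre_cell (w : I -> R) (i : I) :=
  [set x | forall j, j != i -> c i x - w i < c j x - w j].

Hypothesis mc : forall i, measurable_fun setT (c i).

Let measurable_forall (i : I) (P : I -> set T) :
  (forall j, measurable (P j)) ->
  measurable [set x | forall j, j != i -> P j x].
Proof.
move=> mP; rewrite (_ : [set x | _] = \bigcap_(j in [set j | j != i]) P j)//.
by apply: fin_bigcap_measurable => //; exact: finite_finset.
Qed.

Lemma measurable_laguerre_cell w i : measurable (laguerre_cell w i).
Proof.
apply: (measurable_forall i (fun j => [set x | c i x - w i < c j x - w j])) => j.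
apply: measurable_lt_set => //.
  exact: measurable_funB.
exact: measurable_funB.
Qed.

Lemma trivIset_laguerre_cell w : trivIset setT (laguerre_cell w).
Proof.
move=> i j _ _ [x [xi xj]]; apply/eqP; apply: contraT => ij.
have := xi j; rewrite eq_sym ij => /(_ isT).
by have := xj i ij; lra.
Qed.

Lemma laguerre_cell_mono w w' i : w' i <= w i ->
  (forall j, j != i -> w j <= w' j) -> laguerre_cell w' i `<=` laguerre_cell w i.
Proof.
by move=> wi wj x Hx j ji; have := Hx j ji; have := wj j ji; lra.
Qed.

Variable mu : probability T R.
Hypothesis no_ties : forall i j (k : R), i != j ->
  mu [set x | c i x - c j x = k] = 0%E.

Let ties w := \bigcup_ij [set x | ij.1 != ij.2 /\ c ij.1 x - c ij.2 x = w ij.1 - w ij.2].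

Let negligible_ties w : mu.-negligible (ties w).
Proof.
apply: negligible_finite_union => -[i j] /=.
have [ij|ij] := eqVneq i j.
  by apply: negligibleS (negligible_set0 _) => x [].
apply: (@negligibleS _ _ _ _ [set x | c i x - c j x = w i - w j]).
  by move=> x [].
apply/negligibleP; last exact: no_ties.
by apply: measurable_eq_set => //; exact: measurable_funB.
Qed.

Let measurable_weak w i :
  measurable [set x | forall j, j != i -> c i x - w i <= c j x - w j].
Proof.
apply: (measurable_forall i (fun j => [set x | c i x - w i <= c j x - w j])) => j.
by apply: measurable_le_set => //; exact: measurable_funB.
Qed.

(** The two sets differ only by ties. The closed version is the one that arises as a decreasing
    intersection. *)
Lemma measure_weak_laguerre_cell w i :
  mu [set x | forall j, j != i -> c i x - w i <= c j x - w j] =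
  mu (laguerre_cell w i).
Proof.
have mw := measurable_weak w i.
have [N [mN N0 tN]] := negligible_ties w.
apply/eqP; rewrite eq_le; apply/andP; split; last first.
  apply: le_measure; rewrite ?inE//; first exact: measurable_laguerre_cell.
  by move=> x Hx j ji; exact: ltW (Hx j ji).
rewrite -(measureU0 (measurable_laguerre_cell w i) mN N0).
apply: le_measure; rewrite ?inE//.
  by apply: measurableU => //; exact: measurable_laguerre_cell.
move=> x Hx; have [xN|xN] := pselect (N x); [by right|left => j ji].
rewrite lt_neqAle Hx// andbT; apply/eqP => E; apply: xN; apply: tN.
exists (i, j) => //=; split; [by rewrite eq_sym|lra].
Qed.

(** Every point has a minimizing index, and outside the null set of ties the minimum is strict. *)
Lemma sum_measure_laguerre_cell w (i0 : I) :
  (\sum_i mu (laguerre_cell w i) = 1)%E.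
Proof.
rewrite sum_measure_disjoint; [|exact: measurable_laguerre_cell|exact: trivIset_laguerre_cell].
have [N [mN N0 tN]] := negligible_ties w.
have mU : measurable (\bigcup_i laguerre_cell w i).
  apply: fin_bigcup_measurable => [|i _]; first exact: finite_finset.
  exact: measurable_laguerre_cell.
rewrite -(measureU0 mU mN N0) (_ : _ `|` _ = setT); first exact: probability_setT.
apply/seteqP; split => // x _; have [xN|xN] := pselect (N x); [by right|left].
have [i _ Hi] : exists2 i, true & forall j, c i x - w i <= c j x - w j.
  have [i _ Hi] := @Order.TotalTheory.arg_minP _ _ I i0 xpredT (fun i => c i x - w i) isT.
  by exists i => // j; exact: Hi.
exists i => // j ji; rewrite lt_neqAle Hi// andbT; apply/eqP => E; apply: xN; apply: tN.
exists (i, j) => //=; split; [by rewrite eq_sym|lra].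
Qed.

(* Raising [w i] enlarges cell [i] and shrinks all the others.  Hence the
   coordinatewise supremum of the weights whose cells have mass at most [p i] for
   [i != i0] is again such a weight, and it saturates every constraint. *)
Lemma exists_laguerre_weights (i0 : I) (p : I -> R) :
  (forall i, 0 < p i) -> \sum_i p i = 1 ->
  exists w, forall i, mu (laguerre_cell w i) = (p i)%:E.
Proof.
move=> p0 p1.
pose W := [set w : I -> R | w i0 = 0 /\
  forall i, i != i0 -> (mu (laguerre_cell w i) <= (p i)%:E)%E].
have mcell := measurable_laguerre_cell.
(* Very negative weights confine cell i to a tail of c i0 - c i of mass below p i. *)
have [w0 W0] : W !=set0.
  have /choice[M HM] : forall i, exists M, 0 <= M /\
      (mu [set x | M < c i0 x - c i x]%R < (p i)%:E)%E.
    by move=> i; apply: exists_small_tail => //; exact: measurable_funB.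
  exists (fun i => if i == i0 then 0 else - M i); split => [|i ii0]; first by rewrite eqxx.
  apply: le_trans (ltW (HM i).2); apply: le_measure; rewrite ?inE//.
    by apply: measurable_lt_set => //; exact: measurable_funB.
  by move=> x /(_ i0); rewrite eqxx (negbTE ii0) eq_sym ii0 /= => /(_ isT); lra.
(* If w i were too large, cell i0 would lie in a tail of mass below p i0; the other cells have at
   most their share, so the total would be below 1. *)
have W_ub i : exists M, forall w, W w -> w i <= M.
  have [->|ii0] := eqVneq i i0; first by exists 0 => w [->].
  have [M [M0 HM]] := exists_small_tail mu (fun x => c i x - c i0 x) (p i0)
    (measurable_funB (mc i) (mc i0)) (p0 i0).
  exists M => w [w0i Ww]; rewrite leNgt; apply/negP => Mw.
  have cell0 : (mu (laguerre_cell w i0) < (p i0)%:E)%E.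
    apply: le_lt_trans HM; apply: le_measure; rewrite ?inE//.
      by apply: measurable_lt_set => //; exact: measurable_funB.
    by move=> x /(_ i ii0); rewrite w0i /=; lra.
  have := sum_measure_laguerre_cell w i0; rewrite (bigD1 i0)//=.
  apply/eqP; rewrite lt_eqF//.
  apply: (@lt_le_trans _ _ ((p i0)%:E + \sum_(j | j != i0) (p j)%:E)%E).
    apply: lte_leD => //; last by apply: lee_sum => j; exact: Ww.
    rewrite ge0_fin_numE ?sume_ge0//; apply: le_lt_trans (ltry (\sum_(j | j != i0) p j)).
    by rewrite -sumEFin; apply: lee_sum => j; exact: Ww.
  by rewrite sumEFin -EFinD -p1 [X in (_ <= X%:E)%E](bigD1 i0).
pose ws i := sup [set w i | w in W].
have ws_ub w i : W w -> w i <= ws i.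
  move=> Ww; apply: ub_le_sup; last by exists w.
  have [M HM] := W_ub i; exists M => _ [w' Ww' <-]; exact: HM.
have ws_near i (e : R) : 0 < e -> exists2 w, W w & ws i - e < w i.
  move=> e0; have [|_ [w Ww <-] Hw] := @sup_adherent _ [set w i | w in W] e e0.
    split; first by exists (w0 i), w0.
    have [M HM] := W_ub i; exists M => _ [w' Ww' <-]; exact: HM.
  by exists w.
have wsi0 : ws i0 = 0.
  apply/eqP; rewrite eq_le; apply/andP; split; last first.
    by have [<- _] := W0; exact: ws_ub.
  apply: ge_sup; first by exists (w0 i0), w0.
  by move=> _ [w [-> _] <-].
(* If cell i were too heavy, so would be its part [F n] with margin 1 / (n + 1). A weight in W
   within that margin of ws i, and below ws elsewhere, has a cell containing [F n]. *)
have Wws : W ws.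
  split => // i ii0; rewrite leNgt; apply/negP => Hi.
  pose F n := [set x | forall j, j != i ->
     c i x - ws i + n.+1%:R^-1 < c j x - ws j].
  have mF n : measurable (F n).
    apply: (measurable_forall i (fun j => [set x |
       c i x - ws i + n.+1%:R^-1 < c j x - ws j])) => j.
    apply: measurable_lt_set => //.
      by apply: measurable_funD => //; exact: measurable_funB.
    exact: measurable_funB.
  have [||n Hn] := @exists_measure_gt _ _ _ mu F (p i)%:E mF.
  - move=> n m nm; apply/subsetPset => x Hx j ji; apply: le_lt_trans (Hx j ji).
    by rewrite lerD2l lef_pV2 ?posrE// ler_nat.
  - apply: lt_le_trans Hi _; apply: le_measure; rewrite ?inE//.
      exact: bigcupT_measurable.
    move=> x Hx.
    have [r r0 Hr] : exists2 r, 0 < r & forall j, j != i ->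
        c i x - ws i + r < c j x - ws j.
      apply: (common_radius I (fun j r => j != i -> c i x - ws i + r < c j x - ws j)).
        move=> j; have [->|ji] := eqVneq j i; first by exists 1.
        exists ((c j x - ws j - (c i x - ws i)) / 2); have := Hx j ji; lra.
      by move=> j r r' r'r H ji; apply: le_lt_trans (H ji); rewrite lerD2l.
    exists (Num.bound r^-1) => // j ji; apply: le_lt_trans (Hr j ji).
    rewrite lerD2l invf_ple ?posrE//.
    apply: le_trans (ltW (archi_boundP _)) _; first by rewrite invr_ge0 ltW.
    by rewrite ler_nat.
  have [w Ww wi] := ws_near i n.+1%:R^-1 ltac:(by []).
  have /le_lt_trans/(_ Hn) := Ww.2 i ii0; rewrite ltNge => /negP; apply.
  apply: le_measure; rewrite ?inE//.
  move=> x Hx j ji; move: (Hx j ji) (ws_ub w j Ww) wi.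
  by move: (n.+1%:R^-1 : R) => e; lra.
(* If cell i were too light, some enlargement of it by 1 / (n + 1) would still be. Raising ws i by
   this amount stays in W and exceeds the supremum. *)
have ws_eq i : i != i0 -> mu (laguerre_cell ws i) = (p i)%:E.
  move=> ii0; apply/eqP; rewrite eq_le Wws.2//= leNgt; apply/negP => Hi.
  pose F n := [set x | forall j, j != i ->
     c i x - ws i - n.+1%:R^-1 <= c j x - ws j].
  have mF n : measurable (F n).
    apply: (measurable_forall i (fun j => [set x |
       c i x - ws i - n.+1%:R^-1 <= c j x - ws j])) => j.
    apply: measurable_le_set => //.
      by apply: measurable_funB => //; exact: measurable_funB.
    exact: measurable_funB.
  have [||n Hn] := @exists_measure_lt _ _ _ mu F (p i)%:E mF.
  - move=> n m nm; apply/subsetPset => x Hx j ji; apply: le_trans (Hx j ji).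
    by rewrite lerD2l lerN2 lef_pV2 ?posrE// ler_nat.
  - rewrite -measure_weak_laguerre_cell in Hi; apply: le_lt_trans Hi.
    apply: le_measure; rewrite ?inE//; first exact: bigcapT_measurable.
    move=> x Fx j ji; apply/ler_addgt0Pr => e e0.
    have := Fx (Num.bound e^-1) Logic.I j ji.
    have : (Num.bound e^-1).+1%:R^-1 <= e.
      rewrite invf_ple ?posrE//.
      apply: le_trans (ltW (archi_boundP _)) _; first by rewrite invr_ge0 ltW.
      by rewrite ler_nat.
    by move: ((Num.bound e^-1).+1%:R^-1 : R) => r; lra.
  pose w j := if j == i then ws i + n.+1%:R^-1 else ws j.
  have wi : w i = ws i + n.+1%:R^-1 by rewrite /w eqxx.
  have wj j : j != i -> w j = ws j by rewrite /w => /negbTE ->.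
  have Ww : W w.
    split => [|j jj0]; first by rewrite wj ?wsi0// eq_sym.
    have [->|ji] := eqVneq j i.
      apply: le_trans (ltW Hn); apply: le_measure; rewrite ?inE//.
      move=> x Hx k ki; have := Hx k ki; rewrite wi wj//.
      by move: (n.+1%:R^-1 : R) => r; lra.
    apply: le_trans (Wws.2 j jj0); apply: le_measure; rewrite ?inE//.
    apply: laguerre_cell_mono => [|k kj]; first by rewrite wj.
    by rewrite /w; case: eqP => // ->; rewrite lerDl.
  have := ws_ub w i Ww; rewrite wi gerDl leNgt => /negP; apply.
  by rewrite invr_gt0.
(* The mass of cell i0 is what the others leave of the total mass 1. *)
exists ws => i; have [->|/ws_eq//] := eqVneq i i0.
have := sum_measure_laguerre_cell ws i0; rewrite (bigD1 i0)//=.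
rewrite (eq_bigr (fun i => (p i)%:E))// sumEFin.
have -> : \sum_(j | j != i0) p j = 1 - p i0 by rewrite -p1 [in RHS](bigD1 i0)//=; ring.
rewrite -(@fineK _ (mu _)); last by rewrite fin_num_measure.
by rewrite -EFinD => -[] E; congr EFin; lra.
Qed.

End laguerre_cells.

(** * Finite sums of measures and block couplings *)

Section measure_integrals.
Context {d : measure_display} {T : measurableType d} {R : realType}.

Lemma ge0_integral_mrestr (m : {measure set T -> \bar R}) (D : set T)
  (mD : measurable D) (f : T -> \bar R) :
  measurable_fun setT f -> (forall x, 0 <= f x)%E ->
  (\int[mrestr m mD]_x f x = \int[m]_(x in D) f x)%E.
Proof.
move=> mf f0; rewrite (@ge0_negligible_integral _ _ _ _ setT (~` D))//; last first.
  - by rewrite /= /mrestr setICl measure0.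
  - exact: measurableC.
rewrite setTD setCK; apply: eq_measure_integral => A mA AD.
by rewrite /= /mrestr setIidl.
Qed.

Lemma finite_sum_measure (I : finType) (m : I -> {measure set T -> \bar R}) :
  exists M : {measure set T -> \bar R},
    (forall A, M A = \sum_i m i A)%E /\
    (forall f, measurable_fun setT f -> (forall x, 0 <= f x)%E ->
       \int[M]_x f x = \sum_i \int[m i]_x f x)%E.
Proof.
pose s := [seq m i | i <- index_enum I].
pose M : {measure set T -> \bar R} :=
  msum (fun n => nth (mzero : {measure set T -> \bar R}) s n) (size s).
exists M; split => [A|f mf f0].
  transitivity (\sum_(k <- s) (k : {measure set T -> \bar R}) A)%E.
    by rewrite (big_nth (mzero : {measure set T -> \bar R})) big_mkord.
  by rewrite big_map.
rewrite /M ge0_integral_measure_sum//.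
transitivity (\sum_(k <- s) \int[(k : {measure set T -> \bar R})]_x f x)%E.
  by rewrite (big_nth (mzero : {measure set T -> \bar R})) big_mkord.
by rewrite big_map.
Qed.

End measure_integrals.

Section block_coupling.
Context {d : measure_display} {T : measurableType d} {R : realType}.
Variables (nu mu : probability T R).

Lemma integral_rectangle1 (V O : set T) (a : T -> \bar R) :
  measurable V -> measurable O -> measurable_fun setT a ->
  (forall x, 0 <= a x)%E ->
  (\int[nu \x mu]_(z in V `*` O) a z.1 = \int[nu]_(x in V) a x * mu O)%E.
Proof.
move=> mV mO ma a0; rewrite integral_mkcond fubini_tonelli1; last 2 first.
- apply/(measurable_restrictT _ (measurableX mV mO)).
  by apply: measurable_funTS; exact: measurableT_comp.
- by move=> z; exact: erestrict_ge0.
rewrite -ge0_integralZr//; last exact: measurable_funTS.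
rewrite [RHS]integral_mkcond; apply: eq_integral => x _.
rewrite /fubini_F /= patchE; case: ifPn => xV.
  transitivity (\int[mu]_(y in O) a x)%E; last by rewrite integral_cst.
  rewrite [RHS]integral_mkcond; apply: eq_integral => y _.
  by rewrite !patchE in_setX xV.
by rewrite integral0_eq// => y _; rewrite patchE in_setX (negbTE xV).
Qed.

Lemma integral_rectangle2 (V O : set T) (b : T -> \bar R) :
  measurable V -> measurable O -> measurable_fun setT b ->
  (forall x, 0 <= b x)%E ->
  (\int[nu \x mu]_(z in V `*` O) b z.2 = nu V * \int[mu]_(y in O) b y)%E.
Proof.
move=> mV mO mb b0; rewrite integral_mkcond fubini_tonelli2; last 2 first.
- apply/(measurable_restrictT _ (measurableX mV mO)).
  by apply: measurable_funTS; exact: measurableT_comp.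
- by move=> z; exact: erestrict_ge0.
rewrite -ge0_integralZl//; last exact: measurable_funTS.
rewrite [RHS]integral_mkcond; apply: eq_integral => y _.
rewrite /fubini_G /= patchE; case: ifPn => yO.
  transitivity (\int[nu]_(x in V) b y)%E; last by rewrite integral_cst// muleC.
  rewrite [RHS]integral_mkcond; apply: eq_integral => x _.
  by rewrite !patchE in_setX yO andbT.
by rewrite integral0_eq// => x _; rewrite patchE in_setX (negbTE yO) andbF.
Qed.

(** Disjoint blocks of total mass 1 leave only a null set uncovered. *)
Lemma sum_measure_setI (m : probability T R) (I : finType) (V : I -> set T) A :
  (forall i, measurable (V i)) -> trivIset setT V -> (\sum_i m (V i) = 1)%E ->
  measurable A -> (\sum_i m (A `&` V i) = m A)%E.
Proof.
move=> mV tV V1 mA.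
have mAV i : measurable (A `&` V i) by exact: measurableI.
have mU : measurable (\bigcup_i V i).
  by apply: fin_bigcup_measurable => // ; exact: finite_finset.
rewrite sum_measure_disjoint//; last first.
  by apply: trivIset_setIl.
have mN : m (~` \bigcup_i V i) = 0%E.
  by rewrite probability_setC// -sum_measure_disjoint// V1 subee.
rewrite -setI_bigcupr -(@measureU0 _ _ _ m (A `&` \bigcup_i V i) (A `&` ~` \bigcup_i V i)).
- by rewrite -setIUr setUv setIT.
- exact: measurableI.
- by apply: measurableI => //; exact: measurableC.
- apply: subset_measure0 mN; last exact: subIsetr.
    by apply: measurableI => //; exact: measurableC.
  exact: measurableC.
Qed.

(** Take the sum over i of the product measures restricted to V i times O i and divided by p i.
    Equal masses give the right marginals, and on each block a cost bounded by a + b integrates to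
    the two marginal integrals. *)
Lemma block_coupling (I : finType) (V O : I -> set T) (p : I -> R) :
  (forall i, measurable (V i)) -> (forall i, measurable (O i)) ->
  trivIset setT V -> trivIset setT O ->
  (forall i, nu (V i) = (p i)%:E) -> (forall i, mu (O i) = (p i)%:E) ->
  (forall i, 0 < p i) -> \sum_i p i = 1 ->
  exists2 pi : probability (T * T)%type R, coupling nu mu pi &
    forall (f : T * T -> \bar R) (a b : I -> T -> \bar R),
      measurable_fun setT f -> (forall z, 0 <= f z)%E ->
      (forall i, measurable_fun setT (a i)) -> (forall i x, 0 <= a i x)%E ->
      (forall i, measurable_fun setT (b i)) -> (forall i x, 0 <= b i x)%E ->
      (forall i x y, V i x -> O i y -> f (x, y) <= a i x + b i y)%E ->
      (\int[pi]_z f z <=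
       \sum_i (\int[nu]_(x in V i) a i x + \int[mu]_(y in O i) b i y))%E.
Proof.
move=> mV mO tV tO Vp Op p0 p1.
have mVO i : measurable (V i `*` O i) by exact: measurableX.
pose k i : {nonneg R} := NngNum (ltW (etrans (invr_gt0 (p i)) (p0 i))).
pose m i : {measure set (T * T) -> \bar R} :=
  mscale (k i) (mrestr (nu \x mu)%E (mVO i)).
have rectE A B : measurable A -> measurable B ->
  ((nu \x mu) (A `*` B) = nu A * mu B)%E by exact: product_measure1E.
have mE i A : m i A =
  ((p i)^-1%:E * (nu \x mu) (A `&` (V i `*` O i)))%E by [].
have [M [MA Mf]] := finite_sum_measure I m.
have sV : (\sum_i nu (V i) = 1)%E by rewrite (eq_bigr _ (fun i _ => Vp i)) sumEFin p1.
have sO : (\sum_i mu (O i) = 1)%E by rewrite (eq_bigr _ (fun i _ => Op i)) sumEFin p1.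
have M1 A : measurable A -> M (A `*` setT) = nu A.
  move=> mA; rewrite MA -(sum_measure_setI nu I V A)//.
  apply: eq_bigr => i _; rewrite mE -setXI setTI.
  rewrite rectE//; last exact: measurableI.
  by rewrite Op muleC -muleA -EFinM divff ?gt_eqF// mule1.
have M2 A : measurable A -> M (setT `*` A) = mu A.
  move=> mA; rewrite MA -(sum_measure_setI mu I O A)//.
  apply: eq_bigr => i _; rewrite mE -setXI setTI.
  rewrite rectE//; last exact: measurableI.
  by rewrite Vp muleA -EFinM mulVf ?gt_eqF// mul1e.
have MT : M setT = 1%E by rewrite -setXTT M1// probability_setT.
(* [M] has mass 1, so normalizing leaves it unchanged and supplies the structure of a
   probability. *)
pose pi : probability (T * T)%type R := mnormalize M (dirac point).
have piE A : pi A = M A.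
  rewrite /pi /= /mnormalize MT; case: ifPn => [|_]; first by rewrite eqe oner_eq0.
  by rewrite /= invr1 mule1.
exists pi => [A mA|f a b mf f0 ma a0 mb b0 fab].
  by rewrite !piE; split; [exact: M1|exact: M2].
rewrite (eq_measure_integral M) => [|A _ _]; last exact: piE.
rewrite [leLHS](Mf f mf f0); apply: lee_sum => i _.
rewrite /m ge0_integral_mscale// ge0_integral_mrestr//=.
apply: (@le_trans _ _ ((p i)^-1%:E *
   (\int[nu \x mu]_(z in V i `*` O i) (a i z.1 + b i z.2)))%E).
  apply: lee_wpmul2l; first by rewrite lee_fin invr_ge0 ltW.
  apply: ge0_le_integral => //.
  - exact: measurable_funTS.
  - by apply: measurable_funTS; apply: emeasurable_funD; exact: measurableT_comp.
  - by move=> [x y] [/= Vx Oy]; exact: fab.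
rewrite ge0_integralD//; last 2 first.
- by apply: measurable_funTS; exact: measurableT_comp.
- by apply: measurable_funTS; exact: measurableT_comp.
rewrite integral_rectangle1// integral_rectangle2// Vp Op.
have ia : (0 <= \int[nu]_(x in V i) a i x)%E by apply: integral_ge0 => x _.
have ib : (0 <= \int[mu]_(y in O i) b i y)%E by apply: integral_ge0 => y _.
rewrite [X in (_ * (X + _))%E]muleC -ge0_muleDr//.
by rewrite muleA -EFinM mulVf ?gt_eqF// mul1e.
Qed.

End block_coupling.

(** * Integrals over finite partitions *)

Section partition_integrals.
Context {d : measure_display} {T : measurableType d} {R : realType}.
Variables (m : probability T R) (I : finType) (F : I -> set T).
Hypotheses (mF : forall i, measurable (F i)) (tF : trivIset setT F).

Lemma sum_integral_disjoint_le (f : T -> \bar R) :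
  measurable_fun setT f -> (forall x, 0 <= f x)%E ->
  (\sum_i \int[m]_(x in F i) f x <= \int[m]_x f x)%E.
Proof.
move=> mf f0.
have mU : measurable (\big[setU/set0]_(i <- index_enum I) F i).
  exact: bigsetU_measurable.
rewrite -ge0_integral_bigsetU ?index_enum_uniq//.
- exact: ge0_subset_integral.
- by apply: sub_trivIset tF.
- exact: measurable_funTS.
Qed.

Lemma sum_Rintegral_partition (f : T -> R) : (\sum_i m (F i) = 1)%E ->
  m.-integrable setT (EFin \o f) ->
  \sum_i \int[m]_(x in F i) f x = \int[m]_x f x.
Proof.
move=> F1 fi.
have mU : measurable (\big[setU/set0]_(i <- index_enum I) F i).
  exact: bigsetU_measurable.
have UE : \big[setU/set0]_(i <- index_enum I) F i = \bigcup_i F i.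
  apply/seteqP; split => x.
    by rewrite -bigcup_seq => -[i _ Fi]; exists i.
  by move=> [i _ Fi]; rewrite -bigcup_seq; exists i => //=; rewrite mem_index_enum.
have mN : m (~` \big[setU/set0]_(i <- index_enum I) F i) = 0%E.
  by rewrite probability_setC// UE -sum_measure_disjoint// F1 subee.
rewrite /Rintegral (negligible_integral (measurableC mU) measurableT fi mN).
rewrite setTD setCK integral_bigsetU_EFin ?index_enum_uniq//; last 2 first.
- by apply: sub_trivIset tF.
- exact: measurable_funTS (measurable_int _ fi).
rewrite -sum_fine// => i _.
by apply: integrable_fin_num => //; exact: integrableS fi.
Qed.

End partition_integrals.

(** * Finite entropy forces a finite second moment *)

Section second_moment.
Context {d : measure_display} {T : measurableType d} {R : realType}.
Variables (rho : T -> T -> R) (mu nu : probability T R) (C : R).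
Hypotheses (met : is_metric rho) (bor : borel_sigma rho).
Hypotheses (C0 : 0 < C) (lsi : LSI rho mu C).

(** Gibbs' principle for the zero function gives entropy at least 0, which excludes -oo. *)
Lemma relEnt_fin : nu `<< mu -> (relEnt nu mu < +oo)%E ->
  exists H, relEnt nu mu = H%:E.
Proof.
move=> numu Hfin.
have i0 (la : probability T R) c : la.-integrable setT (EFin \o (fun=> c : R)).
  exact: finite_measure_integrable_cst.
have := gibbs_variational nu mu (fun=> 0) numu (i0 nu 0) (i0 mu (expR 0)).
rewrite !Rintegral1 => /(_ (expR_gt0 _)).
by case: (relEnt nu mu) Hfin => [H _ _| |]//; exists H.
Qed.

(** Gibbs' principle for min(rho, n)^2 / (2 C) bounds the truncated moments of nu uniformly in n;
    monotone convergence removes the truncation. *)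
Lemma second_moment_of_relEnt u H : nu `<< mu -> relEnt nu mu = H%:E ->
  (\int[mu]_x ((rho x u) ^+ 2)%:E < +oo)%E ->
  (\int[nu]_x ((rho x u) ^+ 2)%:E < +oo)%E.
Proof.
move=> numu EH mu2.
pose m (n : nat) x := Num.min (rho x u) n%:R.
have m0 n x : 0 <= m n x by rewrite /m le_min metric_ge0//=.
have mm n : measurable_fun setT (fun x => m n x ^+ 2).
  apply: measurable_funX; apply: measurable_minr => //.
  exact: measurable_metric.
have mn n x : m n x ^+ 2 <= n%:R ^+ 2 by rewrite ler_sqr ?nnegrE// /m ge_min lexx orbT.
have ib (la : probability T R) n :
    la.-integrable setT (EFin \o (fun x => m n x ^+ 2 / (2 * C))).
  apply: (@integrable_bounded _ _ _ _ _ (n%:R ^+ 2 / (2 * C))).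
    exact: measurable_funM.
  move=> x; rewrite ger0_norm; last by rewrite divr_ge0 ?sqr_ge0// mulr_ge0// ltW.
  by rewrite ler_pM2r// invr_gt0 mulr_gt0.
have ie n : mu.-integrable setT (EFin \o (expR \o (fun x => m n x ^+ 2 / (2 * C)))).
  apply: (@integrable_bounded _ _ _ _ _ (expR (n%:R ^+ 2 / (2 * C)))).
    by apply: measurableT_comp => //; exact: measurable_funM.
  move=> x; rewrite ger0_norm ?expR_ge0// ler_expR.
  by rewrite ler_pM2r// invr_gt0 mulr_gt0.
pose B := 2 * C * (H + (\int[mu]_x (rho x u ^+ 2)) / C).
have HB n : (\int[nu]_x (m n x ^+ 2)%:E <= B%:E)%E.
  have Z0 : 0 < \int[mu]_x expR (m n x ^+ 2 / (2 * C)).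
    apply: lt_le_trans (jensen_expR _ _ (ib mu n) (ie n)); exact: expR_gt0.
  have := gibbs_variational _ _ _ numu (ib nu n) (ie n) Z0.
  have := ln_expR_truncated_distance _ _ _ met bor C0 lsi u n%:R (ler0n _ n) mu2.
  rewrite EH lee_fin => h1 h2.
  have -> : (\int[nu]_x (m n x ^+ 2)%:E =
      (2 * C * \int[nu]_x (m n x ^+ 2 / (2 * C)))%:E)%E.
    have i1 := integrableZl measurableT (2 * C) (ib nu n).
    transitivity (\int[nu]_x (2 * C * (m n x ^+ 2 / (2 * C)))%:E)%E.
      by apply: eq_integral => x _; congr EFin; field; rewrite gt_eqF.
    by rewrite EFin_Rintegral// RintegralZl//; exact: ib.
  by rewrite lee_fin ler_pM2l ?mulr_gt0//; lra.
apply: (@le_lt_trans _ _ B%:E); last by rewrite ltry.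
have lim x : (m n x ^+ 2)%:E @[n --> \oo] --> (rho x u ^+ 2)%:E.
  apply: cvg_near_cst; exists (Num.bound (rho x u)) => // n /= hn.
  rewrite /m (min_idPl _)//; apply: le_trans (ltW (archi_boundP (metric_ge0 _ met _ _))) _.
  by rewrite ler_nat.
have cv := @cvg_monotone_convergence _ _ _ nu setT measurableT
  (fun n x => (m n x ^+ 2)%:E) _ _ _.
have -> : (\int[nu]_x (rho x u ^+ 2)%:E =
    \int[nu]_x limn (fun n => (m n x ^+ 2)%:E))%E.
  by apply: eq_integral => x _; apply/esym/cvg_lim => //; exact: lim.
apply: (cvge_le _ (cv _ _ _)).
- by apply: nearW => n; exact: HB.
- by move=> n; apply/measurable_EFinP.
- by move=> n x _; rewrite lee_fin sqr_ge0.
- move=> x _ a b ab; rewrite lee_fin ler_sqr ?nnegrE//.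
  by rewrite /m le_min !ge_min lexx/= ler_nat ab orbT.
Qed.

End second_moment.

(** * Approximation by finitely many atoms *)

Section discretization.
Context {d : measure_display} {T : measurableType d} {R : realType}.
Variables (rho : T -> T -> R) (nu : probability T R).
Hypotheses (met : is_metric rho) (bor : borel_sigma rho) (sep : rho_separable rho).

(** Dominated convergence: each point eventually leaves the sets [A n]. *)
Lemma exists_small_tail_integral (f : T -> R) (A : nat -> set T) (e : R) :
  nu.-integrable setT (EFin \o f) -> (forall x, 0 <= f x) ->
  (forall n, measurable (A n)) -> (forall x, \forall n \near \oo, ~ A n x) ->
  0 < e -> exists n, (\int[nu]_(x in A n) (f x)%:E < e%:E)%E.
Proof.
move=> fi f0 mA A0 e0.
have mf : measurable_fun setT (EFin \o f) by exact: measurable_int fi.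
have [] := @dominated_convergence _ _ _ nu setT measurableT
  (fun n => (EFin \o f) \_ (A n)) (cst 0%E) (EFin \o f).
- by move=> n; apply/(measurable_restrictT _ (mA n)); exact: measurable_funTS.
- exact: measurable_cst.
- apply: aeW => x _; apply: cvg_near_cst; have := A0 x; apply: filterS => n An.
  by rewrite patchE memNset.
- exact: fi.
- apply: aeW => x n _; rewrite patchE; case: ifPn => _ /=.
    by rewrite ger0_norm.
  by rewrite normr0 lee_fin.
move=> _ _; rewrite integral0 => cv.
apply: contrapT => H; have : (e%:E <= 0 :> \bar R)%E.
  apply: (cvge_ge _ cv); apply: nearW => n /=; rewrite -integral_mkcond leNgt.
  by apply/negP => Hn; apply: H; exists n.
by rewrite lee_fin leNgt e0.
Qed.

(** Small balls around a dense sequence are made disjoint. The remote remainder is sent to [u0],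
    from which its second moment is small. *)
Lemma metric_discretization (u0 : T) (e : R) : 0 < e ->
  (\int[nu]_x ((rho x u0) ^+ 2)%:E < +oo)%E ->
  exists (I : finType) (u : I -> T) (V : I -> set T),
    [/\ injective u, (forall i, measurable (V i)), trivIset setT V,
        (forall i, (0 < nu (V i))%E) /\ (\sum_i nu (V i) = 1)%E &
        (\sum_i \int[nu]_(x in V i) (rho x (u i) ^+ 2)%:E <= e%:E)%E].
Proof.
move=> e0 nu2; have [dn ddn] := dense_sequence _ sep.
have i2 := integrable_metric_sqr _ met bor nu u0 u0 nu2.
pose r := Num.min 1 (e / 2).
have r0 : 0 < r by rewrite /r lt_min ltr01 divr_gt0.
have r2 : r ^+ 2 <= e / 2.
  have r1 : r <= 1 by rewrite /r ge_min lexx.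
  have re : r <= e / 2 by rewrite /r ge_min lexx orbT.
  by apply: le_trans re; rewrite expr2 ler_piMr// ltW.
(* Index 0 is reserved for [u0], the target of the remainder. *)
pose pt k := if k is k'.+1 then dn k' else u0.
pose far k := [set x | r <= rho x (pt k)].
have mfar k : measurable (far k) by apply: measurable_le_set => //; exact: measurable_metric.
pose Far n := [set x | forall j, (j < n)%N -> far j x].
have mFar n : measurable (Far n).
  rewrite (_ : Far n = \bigcap_(j in [set j | (j < n)%N]) far j)//.
  exact: bigcap_measurableType.
have [n Hn] : exists n, (\int[nu]_(x in Far n.+1) (rho x u0 ^+ 2)%:E < (e / 2)%:E)%E.
  apply: (exists_small_tail_integral (fun x => rho x u0 ^+ 2) (fun n => Far n.+1)) => //.
  - by move=> x; exact: sqr_ge0.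
  - move=> x; have [k Hk] := ddn x r r0.
    exists k.+1 => // m /= km Hx; have := Hx k.+1 km; rewrite /far /=; lra.
  - by rewrite divr_gt0.
(* A point belongs to the first center closer than r; points far from the centers 0 to n join block
   0. *)
pose V k := [set x | (rho x (pt k) < r /\ Far k x) \/ (k = 0%N /\ Far n.+1 x)].
have mV k : measurable (V k).
  have mA : measurable [set x | rho x (pt k) < r].
    by apply: measurable_lt_set => //; exact: measurable_metric.
  have mB : measurable [set x | k = 0%N /\ Far n.+1 x].
    have [->|k0] := eqVneq k 0%N.
      by rewrite (_ : [set x | _] = Far n.+1)//; apply/seteqP; split => x // [].
    rewrite (_ : [set x | _] = set0)// -subset0 => x [k0'].
    by rewrite k0' in k0.
  rewrite (_ : V k = ([set x | rho x (pt k) < r] `&` Far k) `|`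
    [set x | k = 0%N /\ Far n.+1 x]); last by apply/seteqP; split.
  by apply: measurableU => //; exact: measurableI.
have V_disj k l x : (l <= n)%N -> (k < l)%N -> V k x -> V l x -> False.
  move=> ln kl Vk Vl; have [[xl xFl]|[l0 _]] := Vl; last by rewrite l0 in kl.
  have [[xk _]|[_ xF]] := Vk.
    by have := xFl k kl; rewrite /far /=; lra.
  by have := xF l ln; rewrite /far /=; lra.
have V_cover x : exists2 k, (k <= n)%N & V k x.
  have [xF|] := pselect (Far n.+1 x); first by exists 0%N => //; right.
  move=> nF; have /ex_minnP[k] : exists k, ~~ (r <= rho x (pt k)).
    apply: contrapT => H; apply: nF => j _; rewrite /far /=.
    by apply: contrapT => /negP Hj; apply: H; exists j.
  rewrite -ltNge => xk kmin.
  have Fk : Far k x.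
    move=> j jk; rewrite /far /= leNgt -leNgt; apply: contraT => Hj.
    by have := kmin j Hj; rewrite leqNgt jk.
  exists k; last by left.
  rewrite leqNgt; apply/negP => nk; apply: nF => j jn; apply: Fk.
  exact: leq_trans nk.
(* Null blocks are dropped: the weights of the cells require positive masses. *)
pose I := {k : 'I_n.+1 | 0 < fine (nu (V k))}.
pose idx (i : I) : nat := val (val i).
have idxn i : (idx i <= n)%N by rewrite -ltnS; exact: ltn_ord.
have VI0 i : (0 < nu (V (idx i)))%E.
  have := valP i; rewrite -lte_fin fineK//.
  by rewrite fin_num_measure.
have VIx i : exists x, V (idx i) x.
  apply: contrapT => H; have := VI0 i; suff -> : V (idx i) = set0 by rewrite measure0 ltxx.
  by rewrite -subset0 => x Vx; apply: H; exists x.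
have V_inj i j x : V (idx i) x -> V (idx j) x -> i = j.
  move=> Vi Vj; apply: val_inj; apply: val_inj; apply/eqP; apply: contraT.
  rewrite neq_ltn => /orP[ij|ji].
    by have := V_disj _ _ x (idxn j) ij Vi Vj.
  by have := V_disj _ _ x (idxn i) ji Vj Vi.
have tV : trivIset setT (V \o idx).
  by move=> i j _ _ [x [Vi Vj]]; exact: V_inj Vi Vj.
exists I, (pt \o idx), (V \o idx); split => //.
(* A kept block is nonempty, and its points are near its own center but far from all earlier ones,
   so the centers differ. *)
- have lt_neq i j : (idx i < idx j)%N -> pt (idx i) <> pt (idx j).
    move=> ij E; have [x] := VIx j; case=> [[xj xF]|[j0 _]]; last by rewrite j0 in ij.
    by have := xF _ ij; rewrite /far /= E; lra.
  move=> i j /= E; apply: val_inj; apply: val_inj; apply/eqP; apply: contraT.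
  by rewrite neq_ltn => /orP[/lt_neq|/lt_neq/nesym].
- by move=> i; exact: mV.
- split => //; rewrite sum_measure_disjoint//; last by move=> i; exact: mV.
  pose Z (k : 'I_n.+1) := if 0 < fine (nu (V k)) then set0 else V k.
  have nZ : nu.-negligible (\bigcup_k Z k).
    apply: negligible_finite_union => k; rewrite /Z; case: ifPn => Hk.
      exact: negligible_set0.
    apply/negligibleP => //; apply/eqP; rewrite eq_le measure_ge0 andbT.
    rewrite -[X in (X <= _)%E]fineK ?fin_num_measure//.
    by rewrite lee_fin leNgt.
  have [N [mN N0 ZN]] := nZ.
  have mU : measurable (\bigcup_i (V \o idx) i).
    by apply: fin_bigcup_measurable => [|i _]; [exact: finite_finset|exact: mV].
  rewrite -(measureU0 mU mN N0) (_ : _ `|` _ = setT); first exact: probability_setT.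
  apply/seteqP; split => // x _; have [k kn Vk] := V_cover x.
  pose k' : 'I_n.+1 := Ordinal (kn : (k < n.+1)%N).
  have [Hk|Hk] := boolP (0 < fine (nu (V k'))).
    by left; exists (exist _ k' Hk : I).
  by right; apply: ZN; exists k' => //; rewrite /Z (negbTE Hk).
(* One function dominates the cost on all blocks: r^2 near the centers, the squared distance to [u0]
   on the remainder; each part integrates to at most e / 2. *)
pose G x := r ^+ 2 + rho x u0 ^+ 2 * \1_(Far n.+1) x.
have F0 x : 0 <= rho x u0 ^+ 2 * \1_(Far n.+1) x :> R.
  by rewrite mulr_ge0 ?sqr_ge0// indicE.
have G0 x : 0 <= G x by rewrite addr_ge0// sqr_ge0.
have mG : measurable_fun setT G.
  apply: measurable_funD => //; apply: measurable_funM.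
    exact: measurable_metric_sqr.
  exact: measurable_indic.
have VG i x : V (idx i) x -> rho x (pt (idx i)) ^+ 2 <= G x.
  case=> [[xi _]|[i0 xF]].
    apply: le_trans (_ : r ^+ 2 <= _); last by rewrite lerDl.
    by rewrite ler_sqr ?nnegrE ?(ltW r0) ?metric_ge0// ltW.
  by rewrite i0 /G /= indicE mem_set// mulr1 lerDr sqr_ge0.
apply: (@le_trans _ _ (\sum_i \int[nu]_(x in (V \o idx) i) (G x)%:E)%E).
  apply: lee_sum => i _; apply: ge0_le_integral => //.
  - exact: mV.
  - by move=> x _; rewrite lee_fin sqr_ge0.
  - by apply: measurable_funTS; apply/measurable_EFinP; exact: measurable_metric_sqr.
  - by apply: measurable_funTS; apply/measurable_EFinP.
  - by move=> x Vx; rewrite lee_fin VG.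
apply: (@le_trans _ _ (\int[nu]_x (G x)%:E)%E).
- apply: sum_integral_disjoint_le => //; first by move=> i; exact: mV.
  exact/measurable_EFinP.
- rewrite /G; under eq_integral do rewrite EFinD.
  rewrite ge0_integralD//; last 3 first.
  - by move=> x _; rewrite lee_fin sqr_ge0.
  - by move=> x _; rewrite lee_fin.
  - apply/measurable_EFinP; apply: measurable_funM.
      exact: measurable_metric_sqr.
    exact: measurable_indic.
  rewrite integral_cst// [X in (_ * X)%E]probability_setT mule1.
  rewrite (splitr e) EFinD; apply: leeD; first by rewrite lee_fin.
  apply: le_trans (ltW Hn); rewrite [leRHS]integral_mkcond le_eqVlt; apply/orP; left.
  apply/eqP/eq_integral => x _; rewrite patchE indicE.
  by case: ifPn => _; rewrite ?mulr1 ?mulr0.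
Qed.

End discretization.

(** * From the dual estimate to the transport cost *)

Section transport_inequality.
Context {d : measure_display} {T : measurableType d} {R : realType}.
Variables (rho : T -> T -> R) (mu nu : probability T R) (C : R).
Hypotheses (met : is_metric rho) (bor : borel_sigma rho) (sep : rho_separable rho).
Hypotheses (C0 : 0 < C) (lsi : LSI rho mu C).

Lemma integrable_parabola_max (la : probability T R) (I : finType) (i0 : I)
  (u : I -> T) (w : I -> R) b : 0 <= b ->
  (forall v, la.-integrable setT (EFin \o (fun x => rho x v ^+ 2))) ->
  la.-integrable setT (EFin \o parabola_max rho I i0 u w b).
Proof.
move=> b0 la2; pose S x := \sum_i rho x (u i) ^+ 2; pose W := \sum_i `|w i|.
have iS : la.-integrable setT (EFin \o S).
  rewrite (_ : EFin \o S = fun x => (\sum_i (rho x (u i) ^+ 2)%:E)%E).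
    by apply: integrable_sum => // i _; exact: la2.
  by apply/funext => x /=; rewrite sumEFin.
have i1 : la.-integrable setT (EFin \o (fun=> W)).
  exact: finite_measure_integrable_cst.
have i2 : la.-integrable setT (EFin \o (fun x => W + b * S x)).
  exact: (integrableD measurableT i1 (integrableZl measurableT b iS)).
apply: (@integrable_le_scale _ _ _ _ _ (fun x => W + b * S x) 1) => //.
  exact: measurable_parabola_max.
by move=> x; rewrite mul1r; exact: parabola_max_norm.
Qed.

(** Gibbs' principle for s h_s with s = 3 / (4 C), combined with the bound of its exponential moment
    by s times the integral of h_0; dividing by s produces 4 C / 3. *)
Lemma parabola_max_duality (I : finType) (i0 : I) (u : I -> T) (w : I -> R) H :
  nu `<< mu -> relEnt nu mu = H%:E ->
  (forall v, mu.-integrable setT (EFin \o (fun x => rho x v ^+ 2))) ->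
  (forall v, nu.-integrable setT (EFin \o (fun x => rho x v ^+ 2))) ->
  nu.-integrable setT (EFin \o parabola_max rho I i0 u w 4) /\
  \int[nu]_x parabola_max rho I i0 u w 4 x -
    \int[mu]_x parabola_max rho I i0 u w 1 x <= 4 / 3 * C * H.
Proof.
move=> numu EH mu2 nu2; set h := parabola_max rho I i0 u w 4.
have ih (la : probability T R) :
    (forall v, la.-integrable setT (EFin \o (fun x => rho x v ^+ 2))) ->
    la.-integrable setT (EFin \o h) by exact: integrable_parabola_max.
split; first exact: ih.
have s0 : 0 < 3 / (4 * C) by rewrite divr_gt0// mulr_gt0.
pose g x := 3 / (4 * C) * h x.
have mh : measurable_fun setT h by exact: measurable_parabola_max.
have ig (la : probability T R) : la.-integrable setT (EFin \o h) ->
  la.-integrable setT (EFin \o g) by move=> ihla; exact: (integrableZl measurableT (3 / (4 * C)) ihla).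
have ie : mu.-integrable setT (EFin \o (expR \o g)).
  apply: (@integrable_bounded _ _ _ _ _ (expR (3 / (4 * C) * \sum_i `|w i|))).
    by apply: measurableT_comp => //; exact: measurable_funM.
  move=> x; rewrite ger0_norm ?expR_ge0// ler_expR ler_pM2l//.
  exact: parabola_max_le.
have Z0 : 0 < \int[mu]_x expR (g x).
  apply: lt_le_trans (jensen_expR _ _ (ig _ (ih _ mu2)) ie); exact: expR_gt0.
have G := gibbs_variational nu mu g numu (ig _ (ih _ nu2)) ie Z0.
have J := ln_expR_parabola_max rho mu C met bor I i0 u w C0 lsi mu2.
move: G; rewrite EH lee_fin /g RintegralZl//; last exact: ih.
move: J; rewrite -/h -/g ler_pdivrMr//.
set Ln := ln _; set a := \int[nu]_x h x; set b := \int[mu]_x _ => J G.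
have : 3 / (4 * C) * (a - b) <= H by lra.
by rewrite -ler_pdivlMl// invf_div; rewrite (_ : 4 * C / 3 * H = 4 / 3 * C * H)//; ring.
Qed.

(** Error budget: the discretization costs 3 e, the cells cost 3 / 2 times (4 / 3 C H + 4 e), in
    total 2 C H + 9 e. *)
Lemma T2cost_le (u0 : T) (H e : R) :
  (forall (k : R) (u v : T), u <> v ->
     mu [set x | (rho x u) ^+ 2 - (rho x v) ^+ 2 = k] = 0%E) ->
  (\int[mu]_x ((rho x u0) ^+ 2)%:E < +oo)%E ->
  nu `<< mu -> relEnt nu mu = H%:E -> 0 < e ->
  (T2cost rho nu mu <= (2 * C * H + 9 * e)%:E)%E.
Proof.
move=> no_ties mu2 numu EH e0.
have nu2 := second_moment_of_relEnt _ _ _ _ met bor C0 lsi u0 H numu EH mu2.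
have imu v := integrable_metric_sqr _ met bor mu u0 v mu2.
have inu v := integrable_metric_sqr _ met bor nu u0 v nu2.
have [I [u [V [u_inj mV tV [V0 V1] Ve]]]] :=
  metric_discretization rho nu met bor sep u0 e e0 nu2.
have [i0 _|noI] := pickP (xpredT : pred I); last first.
  by move: V1; rewrite big_pred0// => /eqP; rewrite eqe eq_sym oner_eq0.
pose p i := fine (nu (V i)).
have Vp i : nu (V i) = (p i)%:E by rewrite fineK// fin_num_measure.
have p0 i : 0 < p i by rewrite -lte_fin -Vp.
have p1 : \sum_i p i = 1.
  by apply: EFin_inj; rewrite -sumEFin -V1; apply: eq_bigr => i _; rewrite Vp.
pose c i x := rho x (u i) ^+ 2.
have mc i : measurable_fun setT (c i) by exact: measurable_metric_sqr.
have [w Hw] : exists w, forall i, mu (laguerre_cell I c w i) = (p i)%:E.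
  apply: exists_laguerre_weights => // i j k ij; apply: no_ties => E.
  by move: ij; rewrite (u_inj _ _ E) eqxx.
pose O := laguerre_cell I c w.
have mO i : measurable (O i) by exact: measurable_laguerre_cell.
have tO : trivIset setT O by exact: trivIset_laguerre_cell.
have [pi cpi Hpi] := block_coupling nu mu I V O p mV mO tV tO Vp Hw p0 p1.
have [ih4 dual] := parabola_max_duality I i0 u w H numu EH imu inu.
pose h0 := parabola_max rho I i0 u w 1; pose h4 := parabola_max rho I i0 u w 4.
have mrho2 : measurable_fun setT (fun z : T * T => rho z.1 z.2 ^+ 2).
  by apply: measurable_funX; exact: measurable_metric2.
apply: (@le_trans _ _ (\int[pi]_z (rho z.1 z.2 ^+ 2)%:E)%E).
  by apply: ereal_inf_lbound; exists pi.
(* Travel through the atom u i: (a + b)^2 <= 3 a^2 + 3 / 2 b^2, because the difference is (2 a -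
   b)^2 / 2. The weight 3 / 2 turns 4 / 3 into 2. *)
apply: (@le_trans _ _ (\sum_i (\int[nu]_(x in V i) (3 * c i x)%:E +
    \int[mu]_(y in O i) (3 / 2 * c i y)%:E))%E).
  apply: (Hpi _ (fun i x => (3 * c i x)%:E) (fun i y => (3 / 2 * c i y)%:E)).
  - exact/measurable_EFinP.
  - by move=> z; rewrite lee_fin sqr_ge0.
  - by move=> i; apply/measurable_EFinP; exact: measurable_funM.
  - by move=> i x; rewrite lee_fin mulr_ge0 ?sqr_ge0.
  - by move=> i; apply/measurable_EFinP; exact: measurable_funM.
  - by move=> i x; rewrite lee_fin mulr_ge0 ?sqr_ge0.
  - move=> i x y _ _ /=; rewrite -EFinD lee_fin /c.
    have := metric_triangle _ met x (u i) y; rewrite (metricC _ met (u i) y).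
    have := metric_ge0 _ met x y.
    by have := sqr_ge0 (2 * rho x (u i) - rho y (u i)); nra.
have iVc i : nu.-integrable (V i) (EFin \o c i).
  by apply: (integrableS measurableT) (inu (u i)).
have iOc i : mu.-integrable (O i) (EFin \o c i).
  by apply: (integrableS measurableT) (imu (u i)).
have ih0 : mu.-integrable setT (EFin \o h0) by exact: integrable_parabola_max.
have EFin_int (la : probability T R) (D : set T) (f : T -> R) :
    measurable D -> la.-integrable D (EFin \o f) ->
    (\int[la]_(x in D) (f x)%:E)%E = (\int[la]_(x in D) f x)%:E.
  by move=> mD fi; rewrite /Rintegral fineK//; exact: integrable_fin_num.
have eV i : (\int[nu]_(x in V i) (3 * c i x)%:E)%E =
    (3 * \int[nu]_(x in V i) c i x)%:E.
  by rewrite EFin_int ?RintegralZl//; exact: (integrableZl (mV i) 3 (iVc i)).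
have eO i : (\int[mu]_(y in O i) (3 / 2 * c i y)%:E)%E =
    (3 / 2 * \int[mu]_(y in O i) c i y)%:E.
  by rewrite EFin_int ?RintegralZl//; exact: (integrableZl (mO i) (3 / 2) (iOc i)).
under eq_bigr do rewrite eV eO -EFinD.
rewrite sumEFin lee_fin big_split/= -!mulr_sumr.
have Ve' : \sum_i \int[nu]_(x in V i) c i x <= e.
  rewrite -lee_fin -sumEFin; apply: le_trans Ve; rewrite le_eqVlt; apply/orP; left.
  by apply/eqP; apply: eq_bigr => i _; rewrite EFin_int.
(* On its cell the i-th parabola attains the maximum for b = 1, so the cost is exactly w i - h0
   there. *)
have mu_part : \sum_i \int[mu]_(y in O i) c i y =
    \sum_i w i * p i - \int[mu]_x h0 x.
  have O1 : (\sum_i mu (O i) = 1)%E.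
    by rewrite (eq_bigr _ (fun i _ => Hw i)) sumEFin p1.
  rewrite -(sum_Rintegral_partition mu I O mO tO h0 O1 ih0) -sumrB.
  apply: eq_bigr => i _.
  have <- : \int[mu]_(y in O i) w i = w i * p i.
    by rewrite Rintegral_cst// [X in fine X]Hw.
  rewrite -RintegralB//; last 2 first.
  - exact: finite_measure_integrable_cst.
  - exact: integrableS ih0.
  apply: eq_Rintegral => y; rewrite inE => Oy.
  suff -> : h0 y = w i - 1 * c i y by ring.
  have [j hj] := parabola_max_attained rho I i0 u w 1 y.
  have [ji|ji] := eqVneq j i; first by move: hj; rewrite ji.
  have := Oy j ji; have := parabola_max_ge rho I i0 u w 1 i y.
  by rewrite hj /c; lra.
(* On V i, w i <= h4 + 4 c i by the definition of the maximum; the c i integrate to at most e in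
   total. *)
have nu_part : \sum_i w i * p i <= \int[nu]_x h4 x + 4 * e.
  rewrite -(sum_Rintegral_partition nu I V mV tV h4 V1 ih4).
  apply: (@le_trans _ _ (\sum_i \int[nu]_(x in V i) h4 x +
      4 * \sum_i \int[nu]_(x in V i) c i x)); last by lra.
  rewrite mulr_sumr -big_split/=; apply: ler_sum => i _.
  have i4 : nu.-integrable (V i) (EFin \o h4) by exact: integrableS ih4.
  have i4c := integrableZl (mV i) 4 (iVc i).
  rewrite -RintegralZl// -RintegralD//.
  have -> : w i * p i = \int[nu]_(x in V i) w i by rewrite Rintegral_cst.
  apply: le_Rintegral => //.
  - exact: finite_measure_integrable_cst.
  - exact: (integrableD (mV i) i4 i4c).
  - move=> x _; have := parabola_max_ge rho I i0 u w 4 i x.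
    by rewrite -/h4 /c; lra.
move: dual; rewrite -/h0 -/h4 mu_part; lra.
Qed.

End transport_inequality.

Theorem theorem3p4 (d : measure_display) (T : measurableType d) (R : realType)
  (rho : T -> T -> R) (mu : probability T R) (C : R) :
  polish rho -> borel_sigma rho -> P2 rho mu ->
  (forall (k : R) (u v : T), u <> v ->
     mu [set x | (rho x u) ^+ 2 - (rho x v) ^+ 2 = k] = 0%E) ->
  0 < C -> LSI rho mu C -> T2ineq rho mu (2 * C).
Proof.
move=> [met _ sep] bor [u0 mu2] no_ties C0 lsi nu.
(* With infinite entropy the right-hand side is +oo because 2 C > 0; this also covers nu not
   absolutely continuous. *)
have top : relEnt nu mu = +oo%E -> (T2cost rho nu mu <= (2 * C)%:E * relEnt nu mu)%E.
  by move=> ->; rewrite gt0_muley ?leey// lte_fin mulr_gt0.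
have [numu|nnumu] := pselect (nu `<< mu); last first.
  by apply: top; rewrite /relEnt; case: pselect.
have := leey (relEnt nu mu); rewrite le_eqVlt => /orP[/eqP/top//|Hfin].
have [H EH] := relEnt_fin _ _ numu Hfin.
rewrite EH -EFinM; apply/lee_addgt0Pr => e e0.
have e9 : 0 < e / 9 by rewrite divr_gt0.
have := T2cost_le rho mu nu C met bor sep C0 lsi u0 H (e / 9) no_ties mu2 numu EH e9.
by rewrite -EFinD (_ : 9 * (e / 9) = e)//; field.
Qed.
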